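(* For $m\geq 1/2$ let $$\Omega_m=\{z\in\mathbb C^2\colon |z_1|^{2m}+|z_2|^2<1\}.$$ Then for all real $m\geq 1/2$ with $m\neq 2/3$, $m\neq 2$, and all real $b$ with $0\leq b<1$, $$\begin{aligned} \lambda(I_{\Omega_m}((b,0))) =\pi^2\Big[&-\frac{m-1}{2m(3m-2)(3m-1)}b^{6m+2} -\frac{3(m-1)}{2m(m-2)(m+1)}b^{2m+2}\\ &+\frac m{2(m-2)(3m-2)}b^6 +\frac{3m}{3m-1}b^4-\frac{4m-1}{2m}b^2+\frac m{m+1}\Big]. \end{aligned}$$ For $m=2/3$ and $m=2$ and all $b$ with $0\leq b<1$ one has $$\lambda(I_{\Omega_{2/3}}((b,0)))= \frac{\pi^2}{80}\left(-65b^6+40b^6 \log b+160b^4-27b^{10/3}-100b^2+32\right),$$ $$\lambda(I_{\Omega_2}((b,0))) =\frac{\pi^2}{240}\left(-3b^{14}-25b^6-120b^6\log b+288b^4-420b^2+160\right),$$ where $b^6\log b$ is understood to be $0$ at $b=0$.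
   Context: $\Delta$ denotes the open unit disc in $\mathbb C$. For a domain $\Omega\subset\mathbb C^n$ and $w\in\Omega$, the Kobayashi indicatrix of $\Omega$ at $w$ is the set $$I_\Omega(w)=\{\varphi'(0)\colon \varphi\in\mathcal O(\Delta,\Omega),\ \varphi(0)=w\}\subset\mathbb C^n,$$ where $\mathcal O(\Delta,\Omega)$ is the set of holomorphic maps $\Delta\to\Omega$. $\lambda$ denotes Lebesgue measure on $\mathbb C^n\cong\mathbb R^{2n}$ (here $n=2$), and $\log$ is the natural logarithm. *)

(* Defs.v *)
From HB Require Import structures.
From mathcomp Require Import all_boot all_order all_algebra complex.
From mathcomp Require Import all_classical all_reals all_analysis.

Set Implicit Arguments.
Unset Strict Implicit.
Unset Printing Implicit Defensive.

Import Order.TTheory GRing.Theory Num.Theory.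
Import numFieldNormedType.Exports.
Import ComplexField.Normc.

Local Open Scope classical_set_scope.
Local Open Scope ring_scope.

Definition unit_disc (R : realType) : set R[i] := [set z | `|z| < 1].

(* A holomorphic map on the disc is represented by a total function on the
   complex plane; its values off the disc are irrelevant. Derivability is over
   the field R[i], so derivability in the direction 1 is complex
   differentiability. *)
Definition holomorphic_disc_maps (R : realType) (V : normedModType R[i])
    (Omega : set V) : set (R[i] -> V) :=
  [set phi | (forall z, unit_disc z -> derivable (phi : R[i]^o -> V) z 1) /\
             (forall z, unit_disc z -> Omega (phi z))].

Definition kobayashi_indicatrix (R : realType) (V : normedModType R[i])
    (Omega : set V) (w : V) : set V :=
  [set derive1 phi 0 | phi in
    [set phi | holomorphic_disc_maps Omega phi /\ phi 0 = w]].

(* The copy R[i]^o is the one that carries the normed space structure. *)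
Definition C2 (R : realType) : normedModType R[i] := (R[i]^o * R[i]^o)%type.

Definition C2_of_R4 (R : realType) (x : (R * R) * (R * R)) : C2 R :=
  (Complex x.1.1 x.1.2, Complex x.2.1 x.2.2).

Definition lebesgue_measure_C2 (R : realType) (A : set (C2 R)) : \bar R :=
  let mu := @lebesgue_measure R in
  ((mu \x mu) \x (mu \x mu))%E (@C2_of_R4 R @^-1` A).

Definition ellipsoid (R : realType) (m : R) : set (C2 R) :=
  [set z | normc z.1 `^ (2 * m) + normc z.2 ^+ 2 < 1].

(* Main.v *)
Require Import Defs.
From mathcomp Require Import all_boot all_order all_algebra complex.
From mathcomp Require Import all_classical all_reals all_analysis.
From mathcomp Require Import measurable_realfun.
From mathcomp Require Import ring lra.

(** For [b] in [[0, 1)] and [m >= 1/2] the indicatrix [I] of the ellipsoid at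
    [(b, 0)] is determined exactly, and its volume is then an integral in one
    variable.

    The set [I] is invariant under rotations of both coordinates, so it is
    described by the moduli [(x, y)] of its points. Put [beta = b ^ (2 m)]. The
    boundary of [I] consists of two arcs. For [p] in [[0, 1]], the points
    [x = (b/m) p (1 - beta)], [y ^ 2 = (1 - beta) (1 - beta p ^ 2)] come from
    discs whose first component has no zero (for [b > 0]). For [c] in [[b, 1]], the points
    [x = xcurve c], [y ^ 2 = ycurve c] come from discs whose first component has
    a Blaschke factor. Both families are given by the formula for complex
    geodesics of complex ellipsoids.

    That the discs lie in the ellipsoid is an elementary inequality
    ([arc0_in_indicatrix], [arc1_in_indicatrix]). That nothing lies outside the
    arcs is a duality argument ([indicatrix_support]): along an extremal disc the
    outer normals of the convex ellipsoid extend to a holomorphic dual map, and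
    the maximum principle for its pairing with any competing disc gives the
    linear inequality that defines the supporting line of [I] at that point.

    The maximum principle for functions that are only assumed to be complex
    differentiable is obtained from Goursat's theorem on rectangles: in
    logarithmic coordinates it says that the mean over a circle about [0] does
    not depend on the radius ([goursat], [circle_mean], [max_principle]).

    Slicing, the area of discs and the image of the plane measure under the
    squared modulus give
    [vol I = pi ^ 2 * int_0^(s1) F(s) ds], [s1 = (1 - b ^ 2) ^ 2], where [F] is
    [y ^ 2] as a function of [s = x ^ 2] ([reinhardt_volume]). On the first arc
    [F] is affine. On the second one the substitution [s = xcurve c ^ 2] leaves
    a sum of monomials in [c] and [c ^ (2 m)]. Two of these
    monomials acquire the exponent [-1], one for [m = 2] and one for [m = 2/3],
    which is why logarithms appear in these cases. *)

Set Implicit Arguments.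
Unset Strict Implicit.
Unset Printing Implicit Defensive.

Import Order.TTheory GRing.Theory Num.Theory.
Import numFieldNormedType.Exports.
Import ComplexField.Normc.
Local Open Scope classical_set_scope.
Local Open Scope ring_scope.

(** * Complex differentiability in epsilon-delta form *)

Section cdiff.
Variable R : realType.
Implicit Types (f g : R[i] -> R[i]) (z d : R[i]).

Lemma normr_normc (z : R[i]) : `|z| = (normc z)%:C%C.
Proof. by case: z. Qed.

Lemma normc_ge0 (z : R[i]) : 0 <= normc z.
Proof. by case: z => x y /=; rewrite sqrtr_ge0. Qed.

Lemma ltc0_real (r : R[i]) : 0 < r -> exists re : R, r = re%:C%C.
Proof. by case: r => x y; rewrite ltcE /= => /andP[/eqP -> _]; exists x. Qed.

(** Real radii, instead of the positive elements of [R[i]] of the ambient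
    topology, let complex derivatives be compared with real ones. *)
Definition cdiff f z d := forall e : R, 0 < e -> exists2 dl : R, 0 < dl &
  forall h, normc h < dl -> normc (f (z + h) - f z - d * h) <= e * normc h.

Lemma diff_quotientE f z (h : R[i]) :
  h^-1 *: ((f (h *: (1 : R[i]^o) + z) : R[i]^o) - f z) = h^-1 * (f (z + h) - f z).
Proof.
have -> : h *: (1 : R[i]^o) = h by exact: mulr1.
by rewrite [h + z]addrC.
Qed.

Lemma cdiffP f z d :
  is_derive (z : R[i]^o) (1 : R[i]^o) (f : R[i]^o -> R[i]^o) d <-> cdiff f z d.
Proof.
split.
  move=> [df <-] e e0; have := df; rewrite /derivable => /cvg_ex [l hl].
  have -> : 'D_1 (f : R[i]^o -> R[i]^o) z = l by apply: cvg_lim.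
  have e0' : 0 < e%:C%C :> R[i] by rewrite ltcR.
  have /cvgr_dist_le /(_ _ e0') := hl.
  move=> /nbhs_ballP [r /= r0 hr].
  have [re rE] := ltc0_real r0.
  exists re; first by rewrite -ltcR -rE.
  move=> h hd; have [->|h0] := eqVneq h 0.
    by rewrite addr0 mulr0 subrr subr0 normc0 mulr0.
  have := hr h; rewrite /ball /= sub0r normrN normr_normc rE ltcR => /(_ hd h0).
  rewrite diff_quotientE normr_normc lecR.
  move=> H.
  have -> : f (z + h) - f z - l * h = - ((l - h^-1 * (f (z + h) - f z)) * h).
    rewrite mulrBl mulrAC mulVf // mul1r; ring.
  by rewrite normcN normcM ler_wpM2r // normc_ge0.
move=> H.
suff hl : (fun h : R[i]^o => h^-1 *: ((f \o shift z) (h *: (1 : R[i]^o)) - f z : R[i]^o)) @ 0^' --> (d : R[i]^o).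
  have dv : derivable (f : R[i]^o -> R[i]^o) z 1 by apply/cvg_ex; exists d.
  by split => //; apply: cvg_lim.
apply/cvgrPdist_le => e e0.
have [re rE] := ltc0_real e0.
move: e0; rewrite rE ltcR => /H [dl dl0 hdl].
apply/nbhs_ballP; exists dl%:C%C => /=; first by rewrite ltcR.
move=> h; rewrite /ball /= sub0r normrN normr_normc ltcR => /hdl hh h0.
rewrite /= diff_quotientE normr_normc lecR.
rewrite -(ler_pM2r (x := normc h)); last by rewrite lt_neqAle normc_ge0 eq_sym andbT; apply: contra h0 => /eqP/eq0_normc ->.
rewrite -normcM mulrBl mulrAC mulVf // mul1r -normcN opprB.
exact: hh.
Qed.
End cdiff.

(** * Goursat's theorem for closed forms on rectangles *)

Section goursat.
Variable R : realType.
Notation mu := (@lebesgue_measure R).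

Definition sint (f : R -> R) a b := \int[mu]_(x in `[a, b]) f x.

Lemma segment_integrable (f : R -> R) a b : {within `[a, b], continuous f} ->
  mu.-integrable `[a, b] (EFin \o f).
Proof. by move=> cf; apply: continuous_compact_integrable => //; exact: segment_compact. Qed.

Lemma sintD (f : R -> R) a c b : a <= c -> c <= b ->
  {within `[a, b], continuous f} -> sint f a b = sint f a c + sint f c b.
Proof.
move=> ac cb cf; rewrite /sint.
have If := segment_integrable cf.
have := Rintegral_itvB (a := BLeft a) (b := BRight b) (x := c) If.
rewrite !bnd_simp => /(_ ac cb) H.
rewrite -[X in _ = _ + X]Rintegral_itv_obnd_cbnd -?H; last first.
  by apply: integrableS If => //; apply: subset_itv; rewrite ?bnd_simp.
by rewrite addrC subrK.
Qed.

Lemma integral_affine (k p x0 a b : R) : a <= b ->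
  (\int[mu]_(x in `[a, b]) (k + p * (x - x0))%:E =
   (k * (b - a) + p * ((b - x0) ^+ 2 - (a - x0) ^+ 2) / 2)%:E)%E.
Proof.
rewrite le_eqVlt => /predU1P[->|ab].
  by rewrite set_itv1 integral_set1 !subrr !mulr0 mul0r addr0.
pose F x : R := k * x + p * (x - x0) ^+ 2 / 2.
have dF (x : R) : is_derive (x : R) (1 : R) F (k + p * (x - x0)).
  by rewrite /F; apply: is_derive_eq; rewrite /GRing.scale /=; field.
rewrite (@continuous_FTC2 _ _ F) //.
- by rewrite -EFinB /F; congr (_%:E); field.
- apply: derivable_within_continuous => x _ /=.
  have : is_derive (x : R) (1 : R) (fun x : R => k + p * (x - x0)) p.
    by apply: is_derive_eq; rewrite /GRing.scale /=; ring.
  by case.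
- have cF x : {for x, continuous F}.
    by apply/differentiable_continuous/derivable1_diffP; case: (dF x).
  split; first by move=> x _; case: (dF x).
    by apply: cvg_at_right_filter; exact: cF.
  by apply: cvg_at_left_filter; exact: cF.
- by move=> x _; rewrite derive1E; case: (dF x).
Qed.

Lemma sint_affine (k p x0 a b : R) : a <= b ->
  sint (fun x => k + p * (x - x0)) a b =
  k * (b - a) + p * ((b - x0) ^+ 2 - (a - x0) ^+ 2) / 2.
Proof. by move=> ab; rewrite /sint /Rintegral integral_affine. Qed.

Lemma sint_approx (f : R -> R) (k p x0 a b eta : R) : a <= b ->
  {within `[a, b], continuous f} ->
  (forall x, a <= x <= b -> `|f x - (k + p * (x - x0))| <= eta) ->
  `|sint f a b - (k * (b - a) + p * ((b - x0) ^+ 2 - (a - x0) ^+ 2) / 2)|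
    <= eta * (b - a).
Proof.
move=> ab cf H; rewrite -sint_affine //.
have ca : {within `[a, b], continuous (fun x : R => k + p * (x - x0))}.
  apply: derivable_within_continuous => x _ /=.
  have : is_derive (x : R) (1 : R) (fun x : R => k + p * (x - x0)) p.
    by apply: is_derive_eq; rewrite /GRing.scale /=; ring.
  by case.
have cd : {within `[a, b], continuous (fun x : R => f x - (k + p * (x - x0)))}.
  exact: within_continuousB cf ca.
rewrite /sint -RintegralB //; [|exact: segment_integrable|exact: segment_integrable].
apply: le_trans (le_normr_Rintegral _ _) _ => //; first exact: segment_integrable cd.
have -> : eta * (b - a) = \int[mu]_(x in `[a, b]) eta.
  rewrite Rintegral_cst //= lebesgue_measure_itv /= lte_fin; move: ab; rewrite le_eqVlt => /predU1P[->|->] //.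
  by rewrite ltxx subrr.
apply: le_Rintegral => //.
- apply: segment_integrable.
  by move=> x; apply: cvg_norm; exact: cd.
- by apply: segment_integrable; apply: continuous_subspaceT => x; exact: cvg_cst.
Qed.

(** The real linear approximations of [P] and [Q] share the coefficient [q],
    that is [dP/dy = dQ/dx]. Only pointwise differentiability is asked for:
    a holomorphic function is not known to be of class C1 at this stage. *)
Definition closed_form_at (P Q : R -> R -> R) (x0 y0 : R) :=
  exists p q s : R, forall e, 0 < e -> exists2 dl, 0 < dl &
   forall x y, `|x - x0| < dl -> `|y - y0| < dl ->
    `|P x y - (P x0 y0 + p * (x - x0) + q * (y - y0))| <= e * (`|x - x0| + `|y - y0|) /\
    `|Q x y - (Q x0 y0 + q * (x - x0) + s * (y - y0))| <= e * (`|x - x0| + `|y - y0|).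

Lemma diff_approx_continuous (f : R -> R) (x0 p : R) :
  (forall e, 0 < e -> exists2 dl, 0 < dl &
   forall x, `|x - x0| < dl -> `|f x - (f x0 + p * (x - x0))| <= e * `|x - x0|) ->
  {for x0, continuous f}.
Proof.
move=> /(_ 1 ltr01) [dl dl0 H]; apply/cvgrPdist_le => e e0.
have K0 : 0 < `|p| + 1 by rewrite ltr_wpDl.
near=> x.
have xd : `|x - x0| < dl by near: x; exists dl => //= x /=; rewrite distrC.
have xe : `|x - x0| < e / (`|p| + 1).
  by near: x; exists (e / (`|p| + 1)); [exact: divr_gt0|move=> x /=; rewrite distrC].
rewrite distrC.
have -> : f x - f x0 = (f x - (f x0 + p * (x - x0))) + p * (x - x0) by ring.
apply: le_trans (ler_normD _ _) _; rewrite normrM.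
move: xe; rewrite ltr_pdivlMr // => /ltW; apply: le_trans.
by have := H _ xd; lra.
Unshelve. all: by end_near. Qed.

Section rect.
Variables (P Q : R -> R -> R).

(** The integral of [P dx + Q dy] along the boundary of the rectangle
    [[a, b] x [c, d]]. *)
Definition loop a b c d :=
  sint (P^~ c) a b + sint (Q b) c d - sint (P^~ d) a b - sint (Q a) c d.

Definition closed_on a b c d :=
  forall x y, a <= x <= b -> c <= y <= d -> closed_form_at P Q x y.

Lemma closed_contP a b c d y : closed_on a b c d -> c <= y <= d ->
  {within `[a, b], continuous (P^~ y)}.
Proof.
move=> H hy; apply: continuous_in_subspaceT => x; rewrite inE /= in_itv /= => hx.
have [p [q [s Hs]]] := H x y hx hy.
apply: (@diff_approx_continuous _ _ p) => e /Hs [dl dl0 {}Hs]; exists dl => // x' hx'.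
have := Hs x' y hx'; rewrite subrr normr0 => /(_ dl0) [+ _].
by rewrite mulr0 !addr0.
Qed.

Lemma closed_contQ a b c d x : closed_on a b c d -> a <= x <= b ->
  {within `[c, d], continuous (Q x)}.
Proof.
move=> H hx; apply: continuous_in_subspaceT => y; rewrite inE /= in_itv /= => hy.
have [p [q [s Hs]]] := H x y hx hy.
apply: (@diff_approx_continuous _ _ s) => e /Hs [dl dl0 {}Hs]; exists dl => // y' hy'.
have := Hs x y'; rewrite subrr normr0 => /(_ dl0 hy') [_].
by rewrite mulr0 add0r !addr0.
Qed.

Lemma closed_onS a b c d a' b' c' d' : a <= a' -> b' <= b -> c <= c' -> d' <= d ->
  closed_on a b c d -> closed_on a' b' c' d'.
Proof.
move=> h1 h2 h3 h4 H x y /andP[h5 h6] /andP[h7 h8]; apply: H.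
  by rewrite (le_trans h1) // (le_trans h6).
by rewrite (le_trans h3) // (le_trans h8).
Qed.

Lemma loop_split a m b c n d : a <= m -> m <= b -> c <= n -> n <= d ->
  closed_on a b c d ->
  loop a b c d = loop a m c n + loop m b c n + loop a m n d + loop m b n d.
Proof.
move=> am mb cn nd H; have ab := le_trans am mb; have cd := le_trans cn nd.
rewrite /loop.
rewrite (@sintD (P^~ c) a m b) //; last by apply: closed_contP H _; rewrite lexx.
rewrite (@sintD (P^~ d) a m b) //; last by apply: closed_contP H _; rewrite lexx cd.
rewrite (@sintD (Q a) c n d) //; last by apply: closed_contQ H _; rewrite lexx.
rewrite (@sintD (Q b) c n d) //; last by apply: closed_contQ H _; rewrite lexx ab.
ring.
Qed.

(** The affine parts of [P] and [Q] form a closed affine form, whose boundary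
    integral vanishes; only the errors of approximation remain. *)
Lemma loop_small a b c d x0 y0 e dl p q s : a <= x0 <= b -> c <= y0 <= d ->
  0 <= e -> closed_on a b c d -> (b - a) + (d - c) < dl ->
  (forall x y, `|x - x0| < dl -> `|y - y0| < dl ->
    `|P x y - (P x0 y0 + p * (x - x0) + q * (y - y0))| <= e * (`|x - x0| + `|y - y0|) /\
    `|Q x y - (Q x0 y0 + q * (x - x0) + s * (y - y0))| <= e * (`|x - x0| + `|y - y0|)) ->
  `|loop a b c d| <= 2 * e * ((b - a) + (d - c)) ^+ 2.
Proof.
move=> /andP[ax xb] /andP[cy yd] e0 cl small H.
have ab := le_trans ax xb; have cd := le_trans cy yd.
set w := b - a; set h := d - c.
have hx x : a <= x <= b -> `|x - x0| <= w.
  by move=> /andP[? ?]; rewrite /w ler_norml; apply/andP; split; lra.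
have hy y : c <= y <= d -> `|y - y0| <= h.
  by move=> /andP[? ?]; rewrite /h ler_norml; apply/andP; split; lra.
have w0 : 0 <= w by rewrite subr_ge0.
have h0 : 0 <= h by rewrite subr_ge0.
have eP y : c <= y <= d -> `|sint (P^~ y) a b - ((P x0 y0 + q * (y - y0)) * (b - a)
     + p * ((b - x0) ^+ 2 - (a - x0) ^+ 2) / 2)| <= (e * (w + h)) * (b - a).
  move=> yi; apply: sint_approx => //; first exact: closed_contP yi.
  move=> x xi; have := H x y; have := hx _ xi; have := hy _ yi => ? ?.
  case; [rewrite -/w -/h in small; lra|rewrite -/w -/h in small; lra|move=> + _].
  have -> : P x0 y0 + p * (x - x0) + q * (y - y0) = P x0 y0 + q * (y - y0) + p * (x - x0) by ring.
  by move=> /le_trans; apply; rewrite ler_wpM2l // lerD.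
have eQ x : a <= x <= b -> `|sint (Q x) c d - ((Q x0 y0 + q * (x - x0)) * (d - c)
     + s * ((d - y0) ^+ 2 - (c - y0) ^+ 2) / 2)| <= (e * (w + h)) * (d - c).
  move=> xi; apply: sint_approx => //; first exact: closed_contQ xi.
  move=> y yi; have := H x y; have := hx _ xi; have := hy _ yi => ? ?.
  case; [rewrite -/w -/h in small; lra|rewrite -/w -/h in small; lra|move=> _].
  by move=> /le_trans; apply; rewrite ler_wpM2l // lerD.
have := eP c; have := eP d; have := eQ a; have := eQ b.
rewrite !lexx ab cd => /(_ isT) + /(_ isT) + /(_ isT) + /(_ isT).
rewrite -/w -/h !ler_norml /loop.
set A1 := sint _ _ _; set A2 := sint _ _ _; set A3 := sint _ _ _; set A4 := sint _ _ _.
have -> : 2 * e * (w + h) ^+ 2 = 2 * (e * (w + h) * w) + 2 * (e * (w + h) * h) by ring.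
set E1 := e * (w + h) * w; set E2 := e * (w + h) * h.
have -> : b = a + w by rewrite /w; ring.
have -> : d = c + h by rewrite /h; ring.
move=> /andP[? ?] /andP[? ?] /andP[? ?] /andP[? ?].
apply/andP; split; lra.
Qed.

End rect.
End goursat.

Section goursat_thm.
Variable R : realType.
Variables (P Q : R -> R -> R).
Local Notation loopPQ := (loop P Q).
Local Notation closedPQ := (closed_on P Q).

Lemma pow2_small (K e : R) : 0 < e -> exists n, K / 2 ^+ n < e.
Proof.
move=> e0; exists (Num.truncn (`|K| / e)).+1.
rewrite ltr_pdivrMr ?exprn_gt0 // mulrC -ltr_pdivrMr //.
apply: le_lt_trans (_ : `|K| / e < _); first by rewrite ler_pM2r ?invr_gt0 // ler_norm.
apply: lt_le_trans (truncnS_gt _) _.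
by rewrite -natrX ler_nat ltnW // ltn_expl.
Qed.

(** Quartering: if the boundary integral were nonzero, one quarter would carry
    at least a quarter of it. Iterating gives nested rectangles on which the
    integral decreases no faster than the square of the size, which contradicts
    the estimate near their common point. *)
Theorem goursat a c (w h : R) : 0 <= w -> 0 <= h ->
  closedPQ a (a + w) c (c + h) -> loopPQ a (a + w) c (c + h) = 0.
Proof.
move=> w0 h0 cl; apply/eqP; rewrite -normr_le0 leNgt; apply/negP => L0.
set L := `|_| in L0.
have [|wh0] := leP (w + h) 0.
  move=> wh; have [wE hE] : w = 0 /\ h = 0 by split; lra.
  move: L0; rewrite /L /loop /sint wE hE !addr0 !set_itv1 !Rintegral_set1.
  by rewrite !subr0 addr0 normr0 ltxx.
(* [loop_small] bounds a loop by [2 e (w + h) ^ 2], here half of [L]. *)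
pose e : R := L / (4 * (w + h) ^+ 2).
have e0 : 0 < e by rewrite divr_gt0 // mulr_gt0 // exprn_gt0.
pose W n : R := w / 2 ^+ n; pose H n : R := h / 2 ^+ n.
have W0 n : 0 <= W n by rewrite divr_ge0 // exprn_ge0.
have H0 n : 0 <= H n by rewrite divr_ge0 // exprn_ge0.
have p20 n : (2 ^+ n : R) != 0 by rewrite expf_neq0.
have WS n : W n = W n.+1 + W n.+1 by rewrite /W exprS; field.
have HS n : H n = H n.+1 + H n.+1 by rewrite /H exprS; field.
pose bad n (s : R * R) :=
  closedPQ s.1 (s.1 + W n) s.2 (s.2 + H n) /\
  2 * e * (W n + H n) ^+ 2 < `|loopPQ s.1 (s.1 + W n) s.2 (s.2 + H n)|.
pose nest n (s s' : R * R) := (s.1 <= s'.1 /\ s'.1 + W n.+1 <= s.1 + W n) /\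
  (s.2 <= s'.2 /\ s'.2 + H n.+1 <= s.2 + H n).
have step n s : bad n s -> exists s', bad n.+1 s' /\ nest n s s'.
  move=> [cls bs].
  have W1 := W0 n.+1; have H1 := H0 n.+1.
  have WSn := WS n; have HSn := HS n.
  have sub s' : nest n s s' -> closedPQ s'.1 (s'.1 + W n.+1) s'.2 (s'.2 + H n.+1).
    by move=> [[? ?] [? ?]]; apply: closed_onS cls.
  pose m := s.1 + W n.+1; pose k := s.2 + H n.+1.
  have n1 : nest n s (s.1, s.2) by rewrite /nest /=; lra.
  have n2 : nest n s (m, s.2) by rewrite /nest /m /=; lra.
  have n3 : nest n s (s.1, k) by rewrite /nest /k /=; lra.
  have n4 : nest n s (m, k) by rewrite /nest /m /k /=; lra.
  apply: contrapT => no.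
  have small s' : nest n s s' ->
      `|loopPQ s'.1 (s'.1 + W n.+1) s'.2 (s'.2 + H n.+1)| <= 2 * e * (W n.+1 + H n.+1) ^+ 2.
    move=> ns; rewrite leNgt; apply/negP => b'; apply: no; exists s'.
    by split => //; split => //; exact: sub.
  move: bs; apply/negP; rewrite -leNgt.
  have E : loopPQ s.1 (s.1 + W n) s.2 (s.2 + H n) =
      loopPQ s.1 m s.2 k + loopPQ m (m + W n.+1) s.2 k +
      loopPQ s.1 m k (k + H n.+1) + loopPQ m (m + W n.+1) k (k + H n.+1).
    have -> : s.1 + W n = m + W n.+1 by rewrite /m WSn; ring.
    have -> : s.2 + H n = k + H n.+1 by rewrite /k HSn; ring.
    apply: loop_split; rewrite ?/m ?/k; try lra.
    by move: cls; rewrite WSn HSn !addrA.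
  rewrite E WSn HSn.
  have -> : 2 * e * (W n.+1 + W n.+1 + (H n.+1 + H n.+1)) ^+ 2 =
    2 * e * (W n.+1 + H n.+1) ^+ 2 + 2 * e * (W n.+1 + H n.+1) ^+ 2 +
    2 * e * (W n.+1 + H n.+1) ^+ 2 + 2 * e * (W n.+1 + H n.+1) ^+ 2 by ring.
  apply: le_trans (ler_normD _ _) _; apply: lerD; last exact: small n4.
  apply: le_trans (ler_normD _ _) _; apply: lerD; last exact: small n3.
  apply: le_trans (ler_normD _ _) _; apply: lerD; last exact: small n2.
  exact: small n1.
pose nxt n s := get [set s' | bad n.+1 s' /\ nest n s s'].
have nxtP n s : bad n s -> bad n.+1 (nxt n s) /\ nest n s (nxt n s).
  by move=> /step [s' hs']; have := @getPex _ [set s' | bad n.+1 s' /\ nest n s s'] (ex_intro _ s' hs').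
pose fix s n := if n is n'.+1 then nxt n' (s n') else (a, c).
have badn n : bad n (s n).
  elim: n => [|n IH]; last by case: (nxtP _ _ IH).
  rewrite /bad /= /W /H expr0 !divr1; split => //; rewrite -/L.
  have -> : 2 * e * (w + h) ^+ 2 = L / 2 by rewrite /e; field; rewrite gt_eqF.
  lra.
have nestn n : nest n (s n) (s n.+1) by case: (nxtP _ _ (badn n)).
have lim (f : nat -> R) (V : nat -> R) : (forall n, 0 <= V n) ->
    (forall n, f n <= f n.+1 /\ f n.+1 + V n.+1 <= f n + V n) ->
    exists x0, forall n, f n <= x0 <= f n + V n.
  move=> V0 fV.
  have inc n m : f n <= f (n + m)%N.
    by elim: m => [|m IH]; rewrite ?addn0 // addnS (le_trans IH) //; case: (fV (n + m)%N).
  have dec n m : f (n + m)%N + V (n + m)%N <= f n + V n.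
    by elim: m => [|m IH]; rewrite ?addn0 // addnS; apply: le_trans IH; case: (fV (n + m)%N).
  have ub n : ubound (range f) (f n + V n).
    move=> _ [m _ <-]; have [nm|/ltnW mn] := leqP n m.
      by rewrite -(subnKC nm); apply: le_trans (dec n (m - n)%N); rewrite lerDl.
    by apply: le_trans (_ : f n <= _); [rewrite -(subnKC mn) inc|rewrite lerDl].
  exists (sup (range f)) => n; apply/andP; split.
    by apply: ub_le_sup; [exists (f 0%N + V 0%N); exact: ub|exists n].
  by apply: ge_sup; [exists (f 0%N), 0%N|exact: ub].
have [x0 hx0] := lim (fun n => (s n).1) W W0 (fun n => proj1 (nestn n)).
have [y0 hy0] := lim (fun n => (s n).2) H H0 (fun n => proj2 (nestn n)).
have [] := cl x0 y0.
- by have := hx0 0%N; rewrite /= /W expr0 divr1.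
- by have := hy0 0%N; rewrite /= /H expr0 divr1.
move=> p [q [t /(_ _ e0) [dl dl0 small]]].
have [n hn] := pow2_small (w + h) dl0.
have [clb] := badn n; apply/negP; rewrite -leNgt.
have := @loop_small _ P Q _ _ _ _ _ _ _ _ _ _ _ (hx0 n) (hy0 n) (ltW e0) clb _ small.
have -> : (s n).1 + W n - (s n).1 + ((s n).2 + H n - (s n).2) = W n + H n by ring.
by apply; rewrite /W /H -mulrDl.
Qed.

End goursat_thm.

(** * Real differentials of the exponential and of the logarithm *)

Section rdiff.
Variable R : realType.
Implicit Types (U V : R -> R -> R).

Definition rdiff U (x0 y0 p q : R) := forall e, 0 < e -> exists2 dl, 0 < dl &
  forall x y, `|x - x0| < dl -> `|y - y0| < dl ->
    `|U x y - (U x0 y0 + p * (x - x0) + q * (y - y0))| <= e * (`|x - x0| + `|y - y0|).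

Lemma rdiff_closed_form P Q (x0 y0 p q s : R) :
  rdiff P x0 y0 p q -> rdiff Q x0 y0 q s -> closed_form_at P Q x0 y0.
Proof.
move=> dP dQ; exists p, q, s => e e0.
have [d1 d10 h1] := dP e e0; have [d2 d20 h2] := dQ e e0.
exists (Num.min d1 d2); first by rewrite lt_min d10.
move=> x y; rewrite !lt_min => /andP[? ?] /andP[? ?].
by split; [apply: h1|apply: h2].
Qed.

(** The Frechet differential is determined by the two partial derivatives,
    which are computed as derivatives of functions of one real variable. *)
Lemma differentiable_rdiff (U : R * R -> R) (x0 y0 p q : R) :
  differentiable U (x0, y0) ->
  is_derive (x0 : R) (1 : R) (fun x => U (x, y0)) p ->
  is_derive (y0 : R) (1 : R) (fun y => U (x0, y)) q ->
  rdiff (fun x y => U (x, y)) x0 y0 p q.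
Proof.
move=> dU dx dy.
have d10 : 'd U (x0, y0) (1, 0) = p.
  case: dx => _ <-; rewrite -deriveE // /derive.
  apply: (f_equal (fun g : R -> R => lim (g @ 0^'))); apply/funext => h /=.
  have -> : h *: (1, 0) + (x0, y0) = (h%:A + x0, y0) by congr pair; rewrite /= scaler0 add0r.
  by [].
have d01 : 'd U (x0, y0) (0, 1) = q.
  case: dy => _ <-; rewrite -deriveE // /derive.
  apply: (f_equal (fun g : R -> R => lim (g @ 0^'))); apply/funext => h /=.
  have -> : h *: (0, 1) + (x0, y0) = (x0, h%:A + y0) by congr pair; rewrite /= scaler0 add0r.
  by [].
have dE h : 'd U (x0, y0) h = p * h.1 + q * h.2.
  have {1}-> : h = h.1 *: (1, 0) + h.2 *: (0, 1).
    case: h => h1 h2; congr pair; rewrite /= /GRing.scale /=.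
      by rewrite mulr1 mulr0 addr0.
    by rewrite mulr1 mulr0 add0r.
  by rewrite linearD !linearZ d10 d01 /GRing.scale /= ![_ * h.1]mulrC ![_ * h.2]mulrC.
move=> e e0.
have /eqaddoP/(_ _ e0) := diff_locally dU.
move=> /nbhs_ballP [dl /= dl0 H]; exists dl => // x y xd yd.
have := H (x - x0, y - y0); rewrite /ball /=.
have hb : prod_ball (0 : R * R) dl (x - x0, y - y0).
  by split => /=; rewrite /ball /= sub0r normrN.
move=> /(_ hb) H1.
apply: le_trans (_ : e * `|(x - x0, y - y0)| <= _).
  apply: le_trans H1; rewrite le_eqVlt; apply/orP; left; apply/eqP; congr (`|_|).
  rewrite !fctE /= /shift /= dE /=.
  have -> : (x - x0, y - y0) + (x0, y0) = (x, y) by congr pair; rewrite /= subrK.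
  ring.
apply: ler_wpM2l; first exact: ltW.
rewrite prod_normE /= ge_max.
by rewrite lerDl lerDr !normr_ge0.
Qed.

Lemma differentiable1 (f : R -> R) (g : R * R -> R) z d :
  is_derive (g z : R) (1 : R) f d -> differentiable g z -> differentiable (f \o g) z.
Proof.
move=> df dg; apply: differentiable_comp => //.
by apply/derivable1_diffP; case: df.
Qed.

Lemma differentiable_fst (z : R * R) : differentiable (fst : R * R -> R) z.
Proof.
apply: (@linear_differentiable R _ _ (fst : {linear (R * R)%type -> R}) z).
by move=> x; exact: cvg_fst.
Qed.

Lemma differentiable_snd (z : R * R) : differentiable (snd : R * R -> R) z.
Proof.
apply: (@linear_differentiable R _ _ (snd : {linear (R * R)%type -> R}) z).
by move=> x; exact: cvg_snd.
Qed.
Hint Resolve differentiable_fst differentiable_snd : core.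

Lemma rdiff_expcos (x0 y0 : R) :
  rdiff (fun x y => expR x * cos y) x0 y0 (expR x0 * cos y0) (- (expR x0 * sin y0)).
Proof.
apply: (differentiable_rdiff (U := fun z => (expR \o fst) z * (cos \o snd) z)).
- by apply: differentiableM; apply: differentiable1.
- suff : is_derive (x0 : R) (1 : R) (fun x : R => expR x * cos y0) (expR x0 * cos y0) by apply.
  by apply: is_derive_eq; rewrite /GRing.scale /=; ring.
- suff : is_derive (y0 : R) (1 : R) (fun y : R => expR x0 * cos y) (- (expR x0 * sin y0)) by apply.
  by apply: is_derive_eq; rewrite /GRing.scale /=; ring.
Qed.

Lemma rdiff_expsin (x0 y0 : R) :
  rdiff (fun x y => expR x * sin y) x0 y0 (expR x0 * sin y0) (expR x0 * cos y0).
Proof.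
apply: (differentiable_rdiff (U := fun z => (expR \o fst) z * (sin \o snd) z)).
- by apply: differentiableM; apply: differentiable1.
- suff : is_derive (x0 : R) (1 : R) (fun x : R => expR x * sin y0) (expR x0 * sin y0) by apply.
  by apply: is_derive_eq; rewrite /GRing.scale /=; ring.
- suff : is_derive (y0 : R) (1 : R) (fun y : R => expR x0 * sin y) (expR x0 * cos y0) by apply.
  by apply: is_derive_eq; rewrite /GRing.scale /=; ring.
Qed.

Lemma rdiff_lnnorm (x0 y0 : R) : 0 < x0 ->
  rdiff (fun x y => ln (x ^+ 2 + y ^+ 2) / 2) x0 y0
    (x0 / (x0 ^+ 2 + y0 ^+ 2)) (y0 / (x0 ^+ 2 + y0 ^+ 2)).
Proof.
move=> x00.
have p0 : 0 < x0 ^+ 2 + y0 ^+ 2 by rewrite ltr_wpDr ?sqr_ge0 // exprn_gt0.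
apply: (differentiable_rdiff (U := fun z : R * R => (@ln R \o (fun z : R * R => z.1 ^+ 2 + z.2 ^+ 2)) z * 2^-1)).
- apply: differentiableM => //; apply: differentiable1; first exact: is_derive1_ln.
  have -> : (fun z : R * R => z.1 ^+ 2 + z.2 ^+ 2) =
      (fun z : R * R => z.1 * z.1 + z.2 * z.2) by apply/funext => z; rewrite !expr2.
  by apply: differentiableD; apply: differentiableM.
- have dg : is_derive (x0 : R) (1 : R) (fun x : R => x ^+ 2 + y0 ^+ 2) (2 * x0).
    by apply: is_derive_eq; rewrite /GRing.scale /=; ring.
  have dl := @is_derive1_comp _ (@ln R) _ x0 _ _ (is_derive1_ln p0) dg.
  suff : is_derive (x0 : R) (1 : R) (fun x : R => (@ln R \o (fun x : R => x ^+ 2 + y0 ^+ 2)) x / 2)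
    (x0 / (x0 ^+ 2 + y0 ^+ 2)) by apply.
  by apply: is_derive_eq; rewrite /GRing.scale /=; field; rewrite gt_eqF.
- have dg : is_derive (y0 : R) (1 : R) (fun y : R => x0 ^+ 2 + y ^+ 2) (2 * y0).
    by apply: is_derive_eq; rewrite /GRing.scale /=; ring.
  have dl := @is_derive1_comp _ (@ln R) _ y0 _ _ (is_derive1_ln p0) dg.
  suff : is_derive (y0 : R) (1 : R) (fun y : R => (@ln R \o (fun y : R => x0 ^+ 2 + y ^+ 2)) y / 2)
    (y0 / (x0 ^+ 2 + y0 ^+ 2)) by apply.
  by apply: is_derive_eq; rewrite /GRing.scale /=; field; rewrite gt_eqF.
Qed.

Lemma rdiff_atan (x0 y0 : R) : 0 < x0 ->
  rdiff (fun x y => atan (y / x)) x0 y0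
    (- (y0 / (x0 ^+ 2 + y0 ^+ 2))) (x0 / (x0 ^+ 2 + y0 ^+ 2)).
Proof.
move=> x00.
have p0 : 0 < x0 ^+ 2 + y0 ^+ 2 by rewrite ltr_wpDr ?sqr_ge0 // exprn_gt0.
have p1 : 1 + (y0 / x0) ^+ 2 != 0 by rewrite gt_eqF // ltr_wpDr ?sqr_ge0.
apply: (differentiable_rdiff (U := atan \o (fun z : R * R => z.2 * (z.1)^-1))).
- apply: differentiable1; apply: differentiableM => //.
  by apply: differentiableV => //=; rewrite gt_eqF.
- have dg : is_derive (x0 : R) (1 : R) (fun x : R => y0 * x^-1) (- (y0 / x0 ^+ 2)).
    have x0n : x0 != 0 by rewrite gt_eqF.
    have dV : is_derive (x0 : R) (1 : R) (fun x : R => x^-1) (- x0 ^- 2 *: 1).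
      exact: (@is_deriveV _ id).
    apply: (is_derive_eq (is_deriveZ y0 dV)).
    by rewrite /GRing.scale /=; field.
  have da := @is_derive1_comp _ (@atan R) _ x0 _ _ (is_derive1_atan (y0 / x0)) dg.
  apply: is_derive_eq da _.
  by field; rewrite !gt_eqF.
- have dg : is_derive (y0 : R) (1 : R) (fun y : R => y * x0^-1) (x0^-1).
    by apply: is_derive_eq; rewrite /GRing.scale /=; ring.
  have da := @is_derive1_comp _ (@atan R) _ y0 _ _ (is_derive1_atan (y0 / x0)) dg.
  apply: is_derive_eq da _.
  by field; rewrite !gt_eqF.
Qed.
End rdiff.

(** * Cauchy-Riemann equations, exponential and logarithm *)

Section complex_basics.
Variable R : realType.
Implicit Types (z w : R[i]).

Lemma normc_sqrE z : normc z ^+ 2 = complex.Re z ^+ 2 + complex.Im z ^+ 2.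
Proof. by case: z => x y /=; rewrite sqr_sqrtr // addr_ge0 // sqr_ge0. Qed.

Lemma normc_re z : `|complex.Re z| <= normc z.
Proof.
rewrite -(@ler_pXn2r _ 2) ?nnegrE ?normc_ge0 // normc_sqrE real_normK ?num_real //.
by rewrite lerDl sqr_ge0.
Qed.

Lemma normc_im z : `|complex.Im z| <= normc z.
Proof.
rewrite -(@ler_pXn2r _ 2) ?nnegrE ?normc_ge0 // normc_sqrE real_normK ?num_real //.
by rewrite lerDr sqr_ge0.
Qed.

Lemma normc_le_reim z : normc z <= `|complex.Re z| + `|complex.Im z|.
Proof.
rewrite -(@ler_pXn2r _ 2) ?nnegrE ?normc_ge0 ?addr_ge0 // normc_sqrE sqrrD.
rewrite !real_normK ?num_real // addrAC lerDl mulrn_wge0 // mulr_ge0 //.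
Qed.

Lemma cReC (a b : R) : complex.Re (Complex a b) = a. Proof. by []. Qed.
Lemma cImC (a b : R) : complex.Im (Complex a b) = b. Proof. by []. Qed.
Lemma cReR (a : R) : complex.Re a%:C%C = a. Proof. by []. Qed.
Lemma cImR (a : R) : complex.Im a%:C%C = 0. Proof. by []. Qed.
Lemma cReD z w : complex.Re (z + w) = complex.Re z + complex.Re w.
Proof. by case: z; case: w. Qed.
Lemma cImD z w : complex.Im (z + w) = complex.Im z + complex.Im w.
Proof. by case: z; case: w. Qed.
Lemma cReB z w : complex.Re (z - w) = complex.Re z - complex.Re w.
Proof. by case: z; case: w. Qed.
Lemma cImB z w : complex.Im (z - w) = complex.Im z - complex.Im w.
Proof. by case: z; case: w. Qed.
Lemma cReM z w : complex.Re (z * w) = complex.Re z * complex.Re w - complex.Im z * complex.Im w.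
Proof. by case: z; case: w. Qed.
Lemma cImM z w : complex.Im (z * w) = complex.Re z * complex.Im w + complex.Im z * complex.Re w.
Proof. by case: z; case: w. Qed.

Lemma cdiff_rdiff (U V : R -> R -> R) (x0 y0 p q : R) :
  rdiff U x0 y0 p (- q) -> rdiff V x0 y0 q p ->
  cdiff (fun z => Complex (U (complex.Re z) (complex.Im z)) (V (complex.Re z) (complex.Im z)))
    (Complex x0 y0) (Complex p q).
Proof.
move=> dU dV e e0; have e4 : 0 < e / 4 by rewrite divr_gt0.
have [d1 d10 h1] := dU _ e4; have [d2 d20 h2] := dV _ e4.
exists (Num.min d1 d2); first by rewrite lt_min d10.
move=> h; rewrite lt_min => /andP[hd1 hd2].
have hx := normc_re h; have hy := normc_im h.
have H1 := h1 (x0 + complex.Re h) (y0 + complex.Im h).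
have H2 := h2 (x0 + complex.Re h) (y0 + complex.Im h).
rewrite ![_ + _ - _]addrC !addKr in H1 H2.
have {}H1 := H1 (le_lt_trans hx hd1) (le_lt_trans hy hd1).
have {}H2 := H2 (le_lt_trans hx hd2) (le_lt_trans hy hd2).
have eN : e / 4 * (`|complex.Re h| + `|complex.Im h|) <= e / 2 * normc h.
  have -> : e / 2 * normc h = e / 4 * (normc h + normc h) by field.
  by apply: ler_wpM2l; [exact: ltW|rewrite lerD].
have -> : e * normc h = e / 2 * normc h + e / 2 * normc h by field.
apply: le_trans (normc_le_reim _) _.
rewrite !cReB !cImB cReM cImM cReD cImD.
apply: lerD.
  apply: le_trans eN; apply: le_trans H1; rewrite le_eqVlt; apply/orP; left.
  by apply/eqP; congr `|_|; rewrite !cReC !cImC; ring.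
apply: le_trans eN; apply: le_trans H2; rewrite le_eqVlt; apply/orP; left.
by apply/eqP; congr `|_|; rewrite !cReC !cImC; ring.
Qed.

Lemma rdiff_cdiff (f : R[i] -> R[i]) (x0 y0 p q : R) :
  cdiff f (Complex x0 y0) (Complex p q) ->
  rdiff (fun x y => complex.Re (f (Complex x y))) x0 y0 p (- q) /\
  rdiff (fun x y => complex.Im (f (Complex x y))) x0 y0 q p.
Proof.
move=> df.
have main e : 0 < e -> exists2 dl, 0 < dl & forall x y, `|x - x0| < dl -> `|y - y0| < dl ->
    normc (f (Complex x y) - f (Complex x0 y0) - Complex p q * Complex (x - x0) (y - y0))
    <= e * (`|x - x0| + `|y - y0|).
  move=> e0; have [dl dl0 H] := df _ e0.
  exists (dl / 2); first by rewrite divr_gt0.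
  move=> x y hx hy; have hN := normc_le_reim (Complex (x - x0) (y - y0)).
  rewrite cReC cImC in hN.
  move: (H (Complex (x - x0) (y - y0))).
  have -> : Complex x0 y0 + Complex (x - x0) (y - y0) = Complex x y.
    by apply/eqP; rewrite eq_complex /= ![_ + (_ - _)]addrC !subrK !eqxx.
  have lt : normc (Complex (x - x0) (y - y0)) < dl.
    apply: le_lt_trans hN _; lra.
  move=> /(_ lt) /le_trans; apply.
  by apply: ler_wpM2l => //; exact: ltW.
split=> e e0; have [dl dl0 H] := main e e0; exists dl => // x y hx hy;
  apply: le_trans (H x y hx hy).
  apply: le_trans (normc_re _); rewrite !cReB cReM.
  rewrite le_eqVlt; apply/orP; left; apply/eqP; congr `|_|.
  by rewrite !cReC !cImC; ring.
apply: le_trans (normc_im _).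
rewrite !cImB cImM le_eqVlt; apply/orP; left; apply/eqP; congr `|_|.
by rewrite !cReC !cImC; ring.
Qed.

Definition cexp z := Complex (expR (complex.Re z) * cos (complex.Im z))
  (expR (complex.Re z) * sin (complex.Im z)).

Lemma cdiff_exp z : cdiff cexp z (cexp z).
Proof.
case: z => x y; apply: (cdiff_rdiff (U := fun x y => expR x * cos y)
  (V := fun x y => expR x * sin y)); [exact: rdiff_expcos|exact: rdiff_expsin].
Qed.

Lemma normc_exp z : normc (cexp z) = expR (complex.Re z).
Proof.
rewrite /cexp /normc !exprMn -mulrDr cos2Dsin2 mulr1 sqrtr_sqr ger0_norm //; exact: expR_ge0.
Qed.

Lemma cexp_neq0 z : cexp z != 0.
Proof.
apply/eqP => E; have := normc_exp z; rewrite E normc0 => /eqP.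
by rewrite eq_sym gt_eqF // expR_gt0.
Qed.

Lemma cexp0 : cexp 0 = 1.
Proof. by rewrite /cexp /= expR0 cos0 sin0 mulr1 mulr0. Qed.

(** The principal branch on the half-plane [Re z > 0], where the argument is
    [atan (Im z / Re z)]. *)
Definition clog z := Complex (ln (complex.Re z ^+ 2 + complex.Im z ^+ 2) / 2)
  (atan (complex.Im z / complex.Re z)).

Lemma cdiff_log z : 0 < complex.Re z -> cdiff clog z z^-1.
Proof.
case: z => x y /= x0.
apply: (cdiff_rdiff (U := fun x y => ln (x ^+ 2 + y ^+ 2) / 2)
  (V := fun x y => atan (y / x))); first by rewrite opprK; exact: rdiff_lnnorm.
exact: rdiff_atan.
Qed.

Lemma Re_clog z : 0 < complex.Re z -> complex.Re (clog z) = ln (normc z).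
Proof.
move=> z0; have : 0 < normc z.
  by apply: lt_le_trans (normc_re z); rewrite gtr0_norm.
move=> n0; rewrite /clog -normc_sqrE /= lnXn //.
by rewrite -[_ *+ 2]mulr_natr mulfK // pnatr_eq0.
Qed.

End complex_basics.

(** * Rules of complex differentiation *)

Section cdiff_calculus.
Variable R : realType.
Implicit Types (f g : R[i] -> R[i]) (z d : R[i]).

Lemma cdiff_eq f z d d' : cdiff f z d -> d = d' -> cdiff f z d'.
Proof. by move=> ? <-. Qed.

Lemma cdiff_cst (c : R[i]) z : cdiff (fun=> c) z 0.
Proof. by apply/cdiffP; exact: is_derive_cst. Qed.

Lemma cdiff_id z : cdiff id z 1.
Proof. by apply/cdiffP; exact: is_derive_id. Qed.

Lemma cdiffD f g z df dg : cdiff f z df -> cdiff g z dg ->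
  cdiff (fun x => f x + g x) z (df + dg).
Proof. by move=> /cdiffP df1 /cdiffP dg1; apply/cdiffP; exact: is_deriveD. Qed.

Lemma cdiffB f g z df dg : cdiff f z df -> cdiff g z dg ->
  cdiff (fun x => f x - g x) z (df - dg).
Proof. by move=> /cdiffP df1 /cdiffP dg1; apply/cdiffP; exact: is_deriveB. Qed.

Lemma cdiffM f g z df dg : cdiff f z df -> cdiff g z dg ->
  cdiff (fun x => f x * g x) z (f z * dg + g z * df).
Proof. by move=> /cdiffP df1 /cdiffP dg1; apply/cdiffP; exact: is_deriveM. Qed.

Lemma cdiffV f z df : f z != 0 -> cdiff f z df ->
  cdiff (fun x => (f x)^-1) z (- (f z) ^- 2 * df).
Proof.
move=> fz /cdiffP [df1 df2]; apply/cdiffP; split; first exact: derivableV.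
by rewrite deriveV // df2.
Qed.

Lemma normc_triangle (x y : R[i]) : normc (x + y) <= normc x + normc y.
Proof. exact: le_normcD. Qed.

Lemma normc_sub_le (x y : R[i]) : normc x <= normc (x - y) + normc y.
Proof. by rewrite -{1}(subrK y x) le_normcD. Qed.

Lemma cdiff_lip f z d : cdiff f z d -> exists2 dl, 0 < dl &
  forall h, normc h < dl -> normc (f (z + h) - f z) <= (normc d + 1) * normc h.
Proof.
move=> /(_ 1 ltr01) [dl dl0 H]; exists dl => // h /H.
rewrite mul1r => {}H; apply: le_trans (normc_sub_le _ (d * h)) _.
by rewrite normcM mulrDl mul1r addrC lerD2l.
Qed.

Lemma cdiff_comp f g z df dg : cdiff f (g z) df -> cdiff g z dg ->
  cdiff (f \o g) z (df * dg).
Proof.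
move=> Hf Hg e e0.
pose K := normc dg + 1; pose N := normc df + 1.
have K0 : 0 < K by rewrite ltr_wpDl ?normc_ge0.
have N0 : 0 < N by rewrite ltr_wpDl ?normc_ge0.
have [d1 d10 h1] := Hf (e / 2 / K) (divr_gt0 (divr_gt0 e0 (ltr0n _ 2)) K0).
have [d2 d20 h2] := Hg (e / 2 / N) (divr_gt0 (divr_gt0 e0 (ltr0n _ 2)) N0).
have [d3 d30 h3] := cdiff_lip Hg.
exists (Num.min (Num.min d2 d3) (d1 / K)); first by rewrite !lt_min d20 d30 divr_gt0.
move=> h; rewrite !lt_min => /andP[/andP[hd2 hd3]].
rewrite ltr_pdivlMr // mulrC => hd1.
set k := g (z + h) - g z.
have kK : normc k <= K * normc h by exact: h3.
have H1 := h1 k (le_lt_trans kK hd1).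
have H2 := h2 h hd2.
have E : g z + k = g (z + h) by rewrite /k addrC subrK.
rewrite E in H1.
have -> : (f \o g) (z + h) - (f \o g) z - df * dg * h =
  (f (g (z + h)) - f (g z) - df * k) + df * (k - dg * h) by rewrite /=; ring.
apply: le_trans (normc_triangle _ _) _; rewrite normcM.
have -> : e * normc h = e / 2 / K * (K * normc h) + e / 2 / N * N * normc h.
  by field; rewrite !gt_eqF.
apply: lerD.
  apply: le_trans H1 _; apply: ler_wpM2l => //.
  by rewrite ltW // !divr_gt0.
apply: le_trans (_ : normc df * (e / 2 / N * normc h) <= _).
  by apply: ler_wpM2l; [exact: normc_ge0|exact: H2].
have -> : e / 2 / N * N * normc h = N * (e / 2 / N * normc h) by ring.
rewrite ler_wpM2r //.
  by rewrite mulr_ge0 ?normc_ge0 // ltW // !divr_gt0.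
by rewrite lerDl.
Qed.

End cdiff_calculus.

(** * The maximum principle *)

Section max_principle.
Variable R : realType.
Notation mu := (@lebesgue_measure R).
Variables (G : R[i] -> R[i]).

(** In the coordinate [w] with [z = exp w], circles become vertical segments
    and the pull-back of [G] is periodic in the imaginary direction. In Goursat's
    theorem on a rectangle of height [2 pi] the horizontal sides cancel, so the
    two vertical sides carry equal integrals. *)
Lemma circle_mean (t0 : R) : t0 <= 0 ->
  (forall z, 0 < normc z -> normc z <= 1 -> exists d, cdiff G z d) ->
  sint (fun y => complex.Re (G (cexp (Complex 0 y)))) 0 (2 * pi) =
  sint (fun y => complex.Re (G (cexp (Complex t0 y)))) 0 (2 * pi).
Proof.
move=> t00 dG.
pose P x y := complex.Im (G (cexp (Complex x y))).
pose Q x y := complex.Re (G (cexp (Complex x y))).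
have cl : closed_on P Q t0 (t0 + (- t0)) 0 (0 + 2 * pi).
  move=> x y /andP[_ x0] _; have [||d hd] := dG (cexp (Complex x y)).
  - by rewrite normc_exp expR_gt0.
  - by rewrite normc_exp -expR0 ler_expR; rewrite addrN in x0.
  have := cdiff_comp hd (cdiff_exp (Complex x y)).
  case: (d * _) => p q /rdiff_cdiff [h1 h2].
  exact: rdiff_closed_form h2 h1.
have nt0 : 0 <= - t0 by rewrite oppr_ge0.
have pi2 : 0 <= 2 * pi :> R by rewrite mulr_ge0 // pi_ge0.
have := goursat nt0 pi2 cl; rewrite /loop.
have -> : P^~ (0 + 2 * pi) = P^~ 0.
  apply/funext => x; rewrite /P /cexp /= add0r.
  by rewrite mulr_natl cos2pi sin2pi cos0 sin0.
rewrite add0r addrN => H; apply/subr0_eq; rewrite -[RHS]H.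
rewrite -/(Q 0) -/(Q t0); ring.
Qed.

Lemma sint_cst (c a b : R) : a <= b -> sint (fun=> c) a b = c * (b - a).
Proof.
move=> ab; have := sint_affine c 0 0 ab.
by rewrite !mul0r addr0 => <-; congr sint; apply/funext => x; rewrite mul0r addr0.
Qed.

Lemma le_sint (f g : R -> R) a b : {within `[a, b], continuous f} ->
  {within `[a, b], continuous g} -> (forall x, a <= x <= b -> f x <= g x) ->
  sint f a b <= sint g a b.
Proof.
move=> cf cg fg; apply: le_Rintegral => //; try exact: segment_integrable.
Qed.

(** The mean over a circle does not depend on the radius, and it tends to the
    value at the centre. Continuity suffices at [0], so that the lemma applies to
    difference quotients without removing a singularity. *)
Lemma max_principle (M : R) :
  (forall z, 0 < normc z -> normc z <= 1 -> exists d, cdiff G z d) ->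
  (forall e, 0 < e -> exists2 dl, 0 < dl &
    forall z, normc z < dl -> normc (G z - G 0) <= e) ->
  (forall z, normc z = 1 -> complex.Re (G z) <= M) ->
  complex.Re (G 0) <= M.
Proof.
move=> dG cG GM; apply/ler_addgt0Pr => e e0.
have [dl dl0 H] := cG e e0.
(* The circle of radius [expR t0] lies where [G] is within [e] of [G 0]. *)
pose t0 := Num.min 0 (ln (dl / 2)).
have t00 : t0 <= 0 by rewrite /t0 ge_min lexx.
have ht0 : expR t0 < dl.
  apply: le_lt_trans (_ : dl / 2 < _); last lra.
  rewrite -[leRHS]lnK ?posrE ?divr_gt0 // ler_expR /t0 ge_min lexx orbT //.
have twopi : 0 < 2 * pi :> R by rewrite mulr_gt0 // pi_gt0.
have cont t : t <= 0 -> {within `[0, 2 * pi], continuous (fun y => complex.Re (G (cexp (Complex t y))))}.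
  move=> t0'; apply: continuous_in_subspaceT => y _.
  have [||d hd] := dG (cexp (Complex t y)).
  - by rewrite normc_exp expR_gt0.
  - by rewrite normc_exp -expR0 ler_expR.
  have := cdiff_comp hd (cdiff_exp (Complex t y)).
  case: (d * _) => p q /rdiff_cdiff [h1 _].
  apply: (@diff_approx_continuous _ _ _ (- q)) => e1 e10; have [dl1 dl10 {}h1] := h1 _ e10.
  exists dl1 => // y' hy'; have := h1 t y'; rewrite subrr normr0 => /(_ dl10 hy').
  by rewrite mulr0 add0r addr0.
have cc (c : R) : {within `[0, 2 * pi], continuous (fun=> c : R)}.
  by apply: continuous_subspaceT => x; exact: cvg_cst.
have scst (c : R) : sint (fun=> c) 0 (2 * pi) = c * (2 * pi).
  by rewrite sint_cst ?subr0 // ltW.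
have := circle_mean t00 dG.
have up : sint (fun y => complex.Re (G (cexp (Complex 0 y)))) 0 (2 * pi) <= M * (2 * pi).
  rewrite -scst; apply: le_sint; [exact: cont|exact: cc|].
  by move=> y _; apply: GM; rewrite normc_exp expR0.
have lo : (complex.Re (G 0) - e) * (2 * pi) <= sint (fun y => complex.Re (G (cexp (Complex t0 y)))) 0 (2 * pi).
  rewrite -scst; apply: le_sint; [exact: cc|exact: cont|].
  move=> y _; have h := H (cexp (Complex t0 y)).
  rewrite normc_exp in h; have {}h := h ht0.
  have := le_trans (normc_re _) h; rewrite cReB ler_norml => /andP[? _]; lra.
move=> E; rewrite E in up.
have := le_trans lo up; rewrite ler_pM2r // => ?; lra.
Qed.

End max_principle.

(** The maximum principle for [E z / z], extended by [E'(0)] at [0]. *)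
Lemma schwarz_max (R : realType) (E : R[i] -> R[i]) (d0 : R[i]) (M : R) :
  E 0 = 0 -> cdiff E 0 d0 ->
  (forall z, normc z <= 1 -> exists d, cdiff E z d) ->
  (forall z, normc z = 1 -> complex.Re (E z / z) <= M) ->
  complex.Re d0 <= M.
Proof.
move=> E0 dE0 dE EM.
pose G z := if z == 0 then d0 else E z / z.
have -> : d0 = G 0 by rewrite /G eqxx.
apply: max_principle.
- move=> z z0 z1; have zn0 : z != 0 by apply: contraTneq z0 => ->; rewrite normc0 ltxx.
  have [d hd] := dE z z1.
  have hq := cdiffM hd (cdiffV (f := id) zn0 (cdiff_id z)).
  exists (E z * (- z ^- 2 * 1) + z^-1 * d) => e e0.
  have [dl dl0 H] := hq e e0.
  exists (Num.min dl (normc z)); first by rewrite lt_min dl0.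
  move=> h; rewrite lt_min => /andP[hd1 hd2].
  have zh : z + h != 0.
    apply/negP; rewrite addr_eq0 => /eqP zE; move: hd2.
    by rewrite zE normcN ltxx.
  by rewrite /G (negbTE zh) (negbTE zn0); exact: H.
- move=> e e0; have [dl dl0 H] := dE0 e e0; exists dl => // z zd.
  rewrite /G eqxx; have [_|zn0] := eqVneq z 0; first by rewrite subrr normc0 ltW.
  have nz0 : 0 < normc z.
    by rewrite lt_neqAle normc_ge0 andbT eq_sym; apply: contra zn0 => /eqP/eq0_normc ->.
  have := H z zd; rewrite add0r E0 subr0 => h.
  rewrite -(ler_pM2r nz0) -normcM mulrBl divfK //.
- move=> z z1; have zn0 : z != 0.
    by apply/eqP => zE; move: z1; rewrite zE normc0 => /eqP; rewrite eq_sym oner_eq0.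
  by rewrite /G (negbTE zn0); exact: EM.
Qed.

(** * The indicatrix in terms of pairs of scalar functions *)

Section indicatrix_pairs.
Variable R : realType.

Lemma is_derive_pair (phi : R[i]^o -> C2 R) (z : R[i]) (d : C2 R) :
  is_derive (z : R[i]^o) (1 : R[i]^o) phi d <->
  cdiff (fun x => (phi x).1) z d.1 /\ cdiff (fun x => (phi x).2) z d.2.
Proof.
pose q (h : R[i]^o) : C2 R := h^-1 *: ((phi \o shift (z : R[i]^o)) (h *: (1 : R[i]^o)) - phi z).
have isP (V : normedModType R[i]) (f : R[i]^o -> V) (l : V) :
   is_derive (z : R[i]^o) (1 : R[i]^o) f l <->
   ((fun h : R[i]^o => h^-1 *: ((f \o shift (z : R[i]^o)) (h *: (1 : R[i]^o)) - f z)) @ 0^' --> l).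
  split=> [[df <-]|h]; first exact: df.
  have dv : derivable f z 1 by apply/cvg_ex; exists l.
  by split => //; apply: cvg_lim.
split.
  move=> /isP h; split; apply/cdiffP/isP.
    exact: (cvg_comp _ _ h (@cvg_fst _ _ _ _ _)).
  exact: (cvg_comp _ _ h (@cvg_snd _ _ _ _ _)).
move=> [/cdiffP/isP h1 /cdiffP/isP h2]; apply/isP.
have := cvg_pair h1 h2; case: d h1 h2 => d1 d2 h1 h2; apply.
Qed.

Lemma indicatrixP (Omega : set (C2 R)) (w X : C2 R) :
  kobayashi_indicatrix Omega w X <->
  exists f g : R[i] -> R[i],
    [/\ forall z, normc z < 1 -> [/\ exists d, cdiff f z d, exists d, cdiff g z d & Omega (f z, g z)],
        (f 0, g 0) = w, cdiff f 0 X.1 & cdiff g 0 X.2].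
Proof.
split.
  move=> [phi [[dphi Ophi] phi0] <-].
  exists (fun x => (phi x).1), (fun x => (phi x).2).
  have disc z : normc z < 1 -> unit_disc z.
    by move=> z1; rewrite /unit_disc /= normr_normc -[1]/(1%:C%C) ltcR.
  have d0 : is_derive (0 : R[i]^o) (1 : R[i]^o) phi (derive1 phi 0).
    rewrite derive1E; apply: derivableP; apply: dphi; apply: disc.
    by rewrite normc0 ltr01.
  have [h1 h2] := (is_derive_pair _ _ _).1 d0.
  split => //; last by rewrite phi0; case: w {phi0}.
  move=> z /disc z1; have [{}h1 {}h2] := (is_derive_pair _ _ _).1 (derivableP (dphi z z1)).
  split; [by exists ('D_1 (phi : R[i]^o -> C2 R) z).1|by exists ('D_1 (phi : R[i]^o -> C2 R) z).2|].
  by have := Ophi z z1; case: (phi z).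
move=> [f [g [fg fg0 f0 g0]]].
exists (fun z => (f z, g z)).
  split; last exact: fg0.
  split=> z; rewrite /unit_disc /= normr_normc -[1]/(1%:C%C) ltcR => z1.
    have [[d1 h1] [d2 h2] _] := fg z z1.
    have : is_derive (z : R[i]^o) (1 : R[i]^o) ((fun z => (f z, g z)) : R[i]^o -> C2 R) (d1, d2).
      exact/is_derive_pair.
    by case.
  by have [] := fg z z1.
have : is_derive (0 : R[i]^o) (1 : R[i]^o) ((fun z => (f z, g z)) : R[i]^o -> C2 R) X.
  exact/is_derive_pair.
by rewrite derive1E; case.
Qed.
End indicatrix_pairs.

(** * Real powers of quotients of affine functions *)

Section power_quotient.
Variable R : realType.
Implicit Types (al : R) (z : R[i]).

Definition lin al z : R[i] := 1 + al%:C%C * z.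

Lemma cdiff_lin al z : cdiff (lin al) z al%:C%C.
Proof.
apply: cdiff_eq (cdiffD (cdiff_cst 1 z) (cdiffM (cdiff_cst al%:C%C z) (cdiff_id z))) _.
by rewrite mulr0 addr0 mulr1 add0r.
Qed.

Lemma Re_lin al z : complex.Re (lin al z) = 1 + al * complex.Re z.
Proof. by case: z => x y; rewrite /lin /= mul0r subr0. Qed.

Lemma Im_lin al z : complex.Im (lin al z) = al * complex.Im z.
Proof. by case: z => x y; rewrite /lin /= mul0r addr0 add0r. Qed.

Lemma sqr_normc_lin al z :
  normc (lin al z) ^+ 2 = 1 + 2 * al * complex.Re z + al ^+ 2 * normc z ^+ 2.
Proof. by rewrite !normc_sqrE Re_lin Im_lin; ring. Qed.

Lemma Re_lin_gt0 al z : `|al| * normc z < 1 -> 0 < complex.Re (lin al z).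
Proof.
move=> H; rewrite Re_lin.
have : `|al * complex.Re z| < 1.
  by rewrite normrM; apply: le_lt_trans H; rewrite ler_wpM2l // normc_re.
by rewrite ltr_norml => /andP[? _]; lra.
Qed.

Lemma normc_gt0 z : z != 0 -> 0 < normc z.
Proof.
move=> z0; rewrite lt_neqAle normc_ge0 andbT eq_sym.
by apply: contra z0 => /eqP/eq0_normc ->.
Qed.

Lemma Re_gt0_neq0 z : 0 < complex.Re z -> z != 0.
Proof. by move=> z0; apply: contraTneq z0 => ->; rewrite ltxx. Qed.

(** [((1 + al z) / (1 + al0 z)) ^ (1 / m)]. Taking the difference of two
    logarithms on the right half-plane avoids choosing a branch for the
    quotient. *)
Definition qroot (m al al0 : R) z :=
  cexp ((m^-1)%:C%C * (clog (lin al z) - clog (lin al0 z))).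

Lemma qroot_neq0 (m al al0 : R) z : qroot m al al0 z != 0.
Proof. exact: cexp_neq0. Qed.

Lemma qroot0 (m al al0 : R) : qroot m al al0 0 = 1.
Proof. by rewrite /qroot /lin !mulr0 !addr0 subrr mulr0 cexp0. Qed.

Lemma cdiff_qroot (m al al0 : R) z : `|al| * normc z < 1 -> `|al0| * normc z < 1 ->
  cdiff (qroot m al al0) z (qroot m al al0 z *
     ((m^-1)%:C%C * (al%:C%C / lin al z - al0%:C%C / lin al0 z))).
Proof.
move=> h1 h2.
have d1 := cdiff_comp (cdiff_log (Re_lin_gt0 h1)) (cdiff_lin al z).
have d2 := cdiff_comp (cdiff_log (Re_lin_gt0 h2)) (cdiff_lin al0 z).
have d := cdiffM (cdiff_cst (m^-1)%:C%C z) (cdiffB d1 d2).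
apply: cdiff_eq (cdiff_comp (cdiff_exp _) d) _.
by rewrite mulr0 addr0 /qroot /= ![_ * al%:C%C]mulrC ![_ * al0%:C%C]mulrC.
Qed.

Lemma normc_qroot (m al al0 : R) z : 0 < m -> `|al| * normc z < 1 -> `|al0| * normc z < 1 ->
  normc (qroot m al al0 z) `^ (2 * m) =
  normc (lin al z) ^+ 2 / normc (lin al0 z) ^+ 2.
Proof.
move=> m0 h1 h2.
have p1 := Re_lin_gt0 h1; have p2 := Re_lin_gt0 h2.
have n1 : 0 < normc (lin al z) by rewrite normc_gt0 // Re_gt0_neq0.
have n2 : 0 < normc (lin al0 z) by rewrite normc_gt0 // Re_gt0_neq0.
rewrite normc_exp -expRM cReM cReB !Re_clog // cImR cReR mul0r subr0.
have -> : m^-1 * (ln (normc (lin al z)) - ln (normc (lin al0 z))) * (2 * m) =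
   2 * (ln (normc (lin al z)) - ln (normc (lin al0 z))) by field; rewrite gt_eqF.
rewrite -ln_div ?posrE // expRM_natl lnK ?posrE ?divr_gt0 //.
by rewrite expr_div_n.
Qed.

End power_quotient.

(** * Symmetries of the indicatrix *)

Section rotation.
Variables (R : realType) (m b : R).
Local Notation I := (kobayashi_indicatrix (ellipsoid m) ((b%:C%C, 0) : C2 R)).

(** Precomposition with a rotation of the disc turns both components; the
    second one can then be multiplied by any number of modulus at most one. *)
Lemma indicatrix_rotate (X1 X2 om eta : R[i]) : normc om = 1 -> normc eta <= 1 ->
  I (X1, X2) -> I (om * X1, eta * X2).
Proof.
move=> om1 eta1 /indicatrixP [f [g [fg [f0 g0] df dg]]].
have omn0 : om != 0 by apply/eqP => E; move: om1; rewrite E normc0 => /eqP; rewrite eq_sym oner_eq0.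
have dom z : cdiff (fun z => om * z) z om.
  apply: cdiff_eq (cdiffM (cdiff_cst om z) (cdiff_id z)) _.
  by rewrite mulr0 addr0 mulr1.
apply/indicatrixP; exists (fun z => f (om * z)), (fun z => eta * om^-1 * g (om * z)); split.
- move=> z z1; have zom : normc (om * z) < 1 by rewrite normcM om1 mul1r.
  have [[d1 h1] [d2 h2] H] := fg (om * z) zom.
  split.
  + by exists (d1 * om); exact: (cdiff_comp h1 (dom z)).
  + by eexists; exact: (cdiffM (cdiff_cst _ z) (cdiff_comp h2 (dom z))).
  + move: H; rewrite /ellipsoid /=; apply: le_lt_trans; rewrite lerD2l.
    rewrite !normcM normcV om1 invr1 mulr1.
    rewrite ler_pXn2r ?nnegrE ?mulr_ge0 ?normc_ge0 //.
    by rewrite ler_piMl ?normc_ge0.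
- by rewrite mulr0 g0 mulr0 f0.
- have := dom 0; move: df; rewrite -{1}(mulr0 om) => df /(cdiff_comp df) /=.
  by rewrite mulrC.
- have := dom 0; move: dg; rewrite -{1}(mulr0 om) => dg /(cdiff_comp dg) /= h.
  apply: cdiff_eq (cdiffM (cdiff_cst _ 0) h) _.
  by rewrite mulr0 addr0 /=; field.
Qed.

Lemma unimod (z : R[i]) : exists2 om : R[i], normc om = 1 & om * z = (normc z)%:C%C.
Proof.
have [->|z0] := eqVneq z 0; first by exists 1; rewrite ?normc1 // mulr0 normc0.
exists ((normc z)%:C%C / z); last by rewrite divfK.
rewrite normcM normcV /= expr0n /= addr0 sqrtr_sqr ger0_norm ?normc_ge0 // divff //.
by rewrite gt_eqF // normc_gt0.
Qed.

Lemma normc_real (x : R) : normc x%:C%C = `|x|.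
Proof. by rewrite /= expr0n /= addr0 sqrtr_sqr. Qed.

Lemma indicatrix_abs (X1 X2 : R[i]) : I (X1, X2) -> I ((normc X1)%:C%C, (normc X2)%:C%C).
Proof.
have [om h1 <-] := unimod X1; have [eta h2 <-] := unimod X2.
by apply: indicatrix_rotate => //; rewrite h2.
Qed.

Lemma indicatrix_of_real (x y : R) (X1 X2 : R[i]) : 0 <= y -> normc X1 = x -> normc X2 <= y ->
  I (x%:C%C, y%:C%C) -> I (X1, X2).
Proof.
move=> y0 h1 h2; have [om n1 E1] := unimod X1.
have omn : om != 0 by apply/eqP => E; move: n1; rewrite E normc0 => /eqP; rewrite eq_sym oner_eq0.
have -> : X1 = om^-1 * x%:C%C by rewrite -h1 -E1 mulKf.
have [yE|yn0] := eqVneq y 0.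
  have -> : X2 = 0 * y%:C%C.
    rewrite mul0r; apply: eq0_normc; apply/eqP.
    by rewrite eq_le normc_ge0 andbT -yE.
  by apply: indicatrix_rotate; rewrite ?normcV ?n1 ?invr1 // normc0.
have yc : y%:C%C != 0 :> R[i] by rewrite (inj_eq (@complexI R)).
have -> : X2 = X2 / y%:C%C * y%:C%C by rewrite divfK.
apply: indicatrix_rotate; rewrite ?normcV ?n1 ?invr1 //.
rewrite normcM normcV normc_real ger0_norm // ler_pdivrMr ?mul1r //.
by rewrite lt_neqAle eq_sym yn0.
Qed.

End rotation.

(** * The boundary arcs *)

Section powR_bounds.
Variable R : realType.

Lemma powR_lt1 (c e : R) : 0 <= c < 1 -> 0 < e -> c `^ e < 1.
Proof.
move=> /andP[c0 c1] e0.
have -> : (1 : R) = 1 `^ e by rewrite powR1.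
by apply: gt0_ltr_powR; rewrite ?nnegrE.
Qed.

Lemma powR_le1 (c e : R) : 0 <= c <= 1 -> 0 <= e -> c `^ e <= 1.
Proof.
move=> /andP[c0 c1] e0.
have -> : (1 : R) = 1 `^ e by rewrite powR1.
by apply: ge0_ler_powR; rewrite ?nnegrE.
Qed.

Lemma half_le_gt0 (m : R) : 1 / 2 <= m -> 0 < m.
Proof. by apply: lt_le_trans; rewrite divr_gt0. Qed.

Lemma half_le_mul2 (m : R) : 1 / 2 <= m -> 1 <= 2 * m.
Proof. by rewrite ler_pdivrMr // mulrC. Qed.

End powR_bounds.

Section arcs.
Variables (R : realType) (m b : R).

(** The arc of boundary points swept by the extremal discs whose first
    component vanishes at a point of modulus [b / c]: [xcurve c] is the modulus
    of the first component, [ycurve c] the squared modulus of the second one. *)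
Definition xcurve (c : R) :=
  c * (1 - (b / c) ^+ 2 + (b / c) ^+ 2 * (1 - c `^ (2 * m)) / m).
Definition ycurve (c : R) :=
  (1 - c `^ (2 * m)) * (1 - c `^ (2 * m) * (b / c) ^+ 2).

End arcs.

(** * Explicit discs: the indicatrix from inside *)

Section lower.
Variables (R : realType) (m b : R).
Hypothesis m12 : 1 / 2 <= m.
Let m0 : 0 < m. Proof. exact: half_le_gt0. Qed.
Let k1 : 1 <= 2 * m. Proof. exact: half_le_mul2. Qed.
Local Notation k := (2 * m).
Local Notation I := (kobayashi_indicatrix (ellipsoid m) ((b%:C%C, 0) : C2 R)).

Lemma disc_lt (al : R) (z : R[i]) : 0 <= al <= 1 -> normc z < 1 -> `|al| * normc z < 1.
Proof.
move=> /andP[a0 a1] z1; rewrite ger0_norm //; apply: le_lt_trans z1.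
by rewrite ler_piMl // normc_ge0.
Qed.

(** The disc is [z |-> (c B(z) psi(z), A2 z / (1 + a al z))] with
    [psi = ((1 + al z) / (1 + a al z)) ^ (1 / m)] and [a = c ^ (2 m)], the form
    of the complex geodesics of a complex ellipsoid. The last hypothesis is the
    membership in the ellipsoid, multiplied by [|1 + a al z| ^ 2]. *)
Lemma indicatrix_geodesic (c al : R) (B : R[i] -> R[i]) (B0 B1 : R) :
  let a := c `^ k in let A2 := Num.sqrt ((1 - a) * (1 - a * al ^+ 2)) in
  0 <= c -> a <= 1 -> 0 <= al <= 1 ->
  (forall z, normc z < 1 -> exists d, cdiff B z d) ->
  B 0 = B0%:C%C -> cdiff B 0 B1%:C%C -> c * B0 = b ->
  (forall z, normc z < 1 ->
    a * normc (B z) `^ k * normc (lin al z) ^+ 2 + A2 ^+ 2 * normc z ^+ 2 <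
    normc (lin (a * al) z) ^+ 2) ->
  I ((c * (B1 + B0 * (al - a * al) / m))%:C%C, A2%:C%C).
Proof.
move=> a A2 c0 a1 al01 dB BE0 dB0 cB0 ineq.
have a0 : 0 <= a by exact: powR_ge0.
have aal : 0 <= a * al <= 1.
  move/andP: al01 => [? ?]; rewrite mulr_ge0 //=.
  by rewrite -[leRHS]mulr1; apply: ler_pM.
pose psi := qroot m al (a * al).
pose f z := c%:C%C * (B z * psi z).
pose g z := A2%:C%C * (z / lin (a * al) z).
have dpsi z : normc z < 1 -> exists d, cdiff psi z d.
  move=> z1; eexists; apply: cdiff_qroot; exact: disc_lt.
have l0 z : normc z < 1 -> lin (a * al) z != 0.
  by move=> z1; apply: Re_gt0_neq0; apply: Re_lin_gt0; exact: disc_lt.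
have dg z : normc z < 1 -> cdiff g z (A2%:C%C * (z * (- lin (a * al) z ^- 2 * (a * al)%:C%C) +
      (lin (a * al) z)^-1 * 1)).
  move=> z1; have d1 := cdiffM (cdiff_id z) (cdiffV (l0 z z1) (cdiff_lin (a * al) z)).
  by apply: cdiff_eq (cdiffM (cdiff_cst A2%:C%C z) d1) _; rewrite mulr0 addr0.
have df z d1 d2 : cdiff B z d1 -> cdiff psi z d2 -> cdiff f z (c%:C%C * (B z * d2 + psi z * d1)).
  by move=> h1 h2; apply: cdiff_eq (cdiffM (cdiff_cst c%:C%C z) (cdiffM h1 h2)) _; rewrite mulr0 addr0.
have z01 : normc (0 : R[i]) < 1 by rewrite normc0.
have lin0 x : lin x 0 = 1 :> R[i] by rewrite /lin mulr0 addr0.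
apply/indicatrixP; exists f, g; split.
- move=> z z1; split.
  + have [d1 h1] := dB z z1; have [d2 h2] := dpsi z z1.
    by eexists; exact: df h1 h2.
  + by eexists; exact: dg.
  + have nl : 0 < normc (lin (a * al) z) ^+ 2 by rewrite exprn_gt0 // normc_gt0 // l0.
    rewrite /ellipsoid /= -/(normc _) /f /g !normcM normcV !normc_real ger0_norm //.
    rewrite !powRM ?mulr_ge0 ?normc_ge0 // normc_qroot //; try exact: disc_lt.
    rewrite -/a [`|A2|]ger0_norm ?sqrtr_ge0 // !exprMn exprVn.
    rewrite -(ltr_pM2r nl) mul1r; apply: le_lt_trans (ineq z z1).
    by rewrite le_eqVlt; apply/orP; left; apply/eqP; field; rewrite gt_eqF // normc_gt0 // l0.
- by rewrite /f /g mul0r mulr0 BE0 /psi qroot0 mulr1 -rmorphM cB0.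
- have hpsi : cdiff psi 0 (((al - a * al) / m)%:C%C).
    apply: cdiff_eq (cdiff_qroot _ _ _) _; try exact: disc_lt.
    by rewrite qroot0 !lin0 !divr1 mul1r -rmorphB -rmorphM mulrC.
  apply: cdiff_eq (df _ _ _ dB0 hpsi) _.
  rewrite BE0 /psi qroot0 mul1r -!rmorphM -rmorphD -rmorphM /=; congr (_%:C%C); ring.
- apply: cdiff_eq (dg _ z01) _.
  by rewrite mul0r add0r lin0 invr1 !mulr1.
Qed.

Lemma sqrt_factor_ge0 (a al : R) : 0 <= a <= 1 -> 0 <= al <= 1 ->
  0 <= (1 - a) * (1 - a * al ^+ 2).
Proof.
move=> /andP[a0 a1] /andP[l0 l1]; apply: mulr_ge0; first lra.
rewrite subr_ge0 -[leRHS]mulr1; apply: ler_pM => //; first exact: sqr_ge0.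
by rewrite exprn_ile1.
Qed.

Lemma sqr_normc_lt1 (z : R[i]) : normc z < 1 -> normc z ^+ 2 < 1.
Proof. by move=> z1; rewrite exprn_ilt1 // normc_ge0. Qed.

Lemma normc_lt_sqrt (X : R[i]) (Y : R) : normc X ^+ 2 <= Y -> normc X <= Num.sqrt Y.
Proof. by move=> h; rewrite -[normc X]ger0_norm ?normc_ge0 // -sqrtr_sqr ler_wsqrtr. Qed.

(** Discs with [B = 1], whose first component has no zero if [b > 0]. Membership
    reduces to [0 < (1 - beta) (1 - |z| ^ 2)] with [beta = b ^ (2 m)]. *)
Lemma arc0_in_indicatrix (p : R) (X1 X2 : R[i]) : 0 <= b < 1 -> 0 <= p <= 1 ->
  normc X1 = b / m * p * (1 - b `^ k) ->
  normc X2 ^+ 2 <= (1 - b `^ k) * (1 - b `^ k * p ^+ 2) -> I (X1, X2).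
Proof.
move=> /andP[b0 b1] p01 h1 h2; set a := b `^ k in h1 h2.
have a1 : a < 1.
  by apply: powR_lt1; rewrite ?b0 // mulr_gt0.
have a01 : 0 <= a <= 1 by rewrite powR_ge0 ltW.
apply: (@indicatrix_of_real _ _ _ (b * (0 + 1 * (p - a * p) / m)) (Num.sqrt ((1 - a) * (1 - a * p ^+ 2)))).
- exact: sqrtr_ge0.
- by rewrite h1; field; rewrite gt_eqF.
- exact: normc_lt_sqrt.
apply: (@indicatrix_geodesic b p (fun=> 1)) => //.
- exact: ltW.
- by move=> z _; exists 0; exact: cdiff_cst.
- exact: cdiff_cst.
- by rewrite mulr1.
move=> z /sqr_normc_lt1 z1; rewrite normc1 powR1 mulr1.
rewrite sqr_sqrtr ?sqrt_factor_ge0 // !sqr_normc_lin.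
rewrite -subr_gt0.
have -> : 1 + 2 * (b `^ k * p) * complex.Re z + (b `^ k * p) ^+ 2 * normc z ^+ 2 -
   (b `^ k * (1 + 2 * p * complex.Re z + p ^+ 2 * normc z ^+ 2) +
    (1 - b `^ k) * (1 - b `^ k * p ^+ 2) * normc z ^+ 2) =
   (1 - b `^ k) * (1 - normc z ^+ 2) by ring.
by rewrite mulr_gt0 // subr_gt0.
Qed.

(** Discs with the Blaschke factor [B = (z + al) / (1 + al z)], [al = b / c].
    Since [2 m >= 1] and [|B| <= 1], the power [|B| ^ (2 m)] is at most [|B|];
    the inequality between arithmetic and geometric means then gives the
    membership. *)
Lemma arc1_in_indicatrix (c : R) (X1 X2 : R[i]) : 0 <= b < 1 -> 0 < c -> b <= c <= 1 ->
  normc X1 = xcurve m b c -> normc X2 ^+ 2 <= ycurve m b c -> I (X1, X2).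
Proof.
rewrite /xcurve /ycurve => /andP[b0 b1] c0 /andP[bc c1] h1 h2; set a := c `^ k in h1 h2.
have a1 : a <= 1.
  by apply: powR_le1; rewrite ?(ltW c0) // mulr_ge0 // ltW.
have a01 : 0 <= a <= 1 by rewrite powR_ge0.
pose al := b / c.
have al01 : 0 <= al <= 1 by rewrite divr_ge0 ?(ltW c0) //= ler_pdivrMr // mul1r.
have strict : a * (1 + al ^+ 2) < 2.
  move/andP: al01 => [al0 al1].
  have al2 : al ^+ 2 <= 1 by rewrite exprn_ile1.
  have [cE|cn1] := eqVneq c 1.
    have : al ^+ 2 < 1 by rewrite /al cE divr1 exprn_ilt1.
    move=> ?; apply: le_lt_trans (_ : 1 * (1 + al ^+ 2) < _); last lra.
    by rewrite ler_wpM2r // addr_ge0 // sqr_ge0.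
  have a1' : a < 1.
    by apply: powR_lt1; rewrite ?mulr_gt0 // (ltW c0) lt_neqAle cn1.
  apply: lt_le_trans (_ : 1 * (1 + al ^+ 2) <= _); last lra.
  by rewrite ltr_pM2r // ltr_wpDr // sqr_ge0.
apply: (@indicatrix_of_real _ _ _ (c * ((1 - al ^+ 2) + al * (al - a * al) / m))
    (Num.sqrt ((1 - a) * (1 - a * al ^+ 2)))).
- exact: sqrtr_ge0.
- by rewrite h1 /al; field; rewrite !gt_eqF.
- exact: normc_lt_sqrt.
have lal z : normc z < 1 -> lin al z != 0.
  by move=> z1; apply: Re_gt0_neq0; apply: Re_lin_gt0; exact: disc_lt.
have dB z : normc z < 1 -> cdiff (fun z => (z + al%:C%C) / lin al z) z
    ((z + al%:C%C) * (- lin al z ^- 2 * al%:C%C) + (lin al z)^-1 * (1 + 0)).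
  move=> z1; apply: (cdiffM (f := fun z => z + al%:C%C)); first exact: (cdiffD (cdiff_id z) (cdiff_cst _ z)).
  exact: (cdiffV (lal z z1) (cdiff_lin al z)).
apply: (@indicatrix_geodesic c al (fun z => (z + al%:C%C) / lin al z)) => //.
- exact: ltW.
- by move=> z z1; eexists; exact: dB.
- by rewrite /lin mulr0 addr0 add0r divr1.
- apply: cdiff_eq (dB 0 _) _; first by rewrite normc0.
  rewrite /lin mulr0 !addr0 add0r invr1 expr1n invr1 mul1r mulN1r mulrN -rmorphM.
  by rewrite -expr2 addrC rmorphB rmorph1.
- by rewrite /al mulrC divfK // gt_eqF.
move=> z z1; have z2 := sqr_normc_lt1 z1.
rewrite -/a sqr_sqrtr ?sqrt_factor_ge0 //.
have n1 : 0 < normc (lin al z) by rewrite normc_gt0 // lal.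
have nza : normc (z + al%:C%C) ^+ 2 = normc z ^+ 2 + 2 * al * complex.Re z + al ^+ 2.
  by rewrite !normc_sqrE cReD cImD cReR cImR; ring.
have n1E := sqr_normc_lin al z.
have tle1 : normc (z + al%:C%C) <= normc (lin al z).
  rewrite -(@ler_pXn2r _ 2) ?nnegrE ?normc_ge0 // nza n1E -subr_ge0.
  have -> : 1 + 2 * al * complex.Re z + al ^+ 2 * normc z ^+ 2 -
    (normc z ^+ 2 + 2 * al * complex.Re z + al ^+ 2) = (1 - al ^+ 2) * (1 - normc z ^+ 2) by ring.
  apply: mulr_ge0; last lra.
  by move/andP: al01 => [? ?]; rewrite subr_ge0 exprn_ile1.
have tk : normc ((z + al%:C%C) / lin al z) `^ k <= normc (z + al%:C%C) / normc (lin al z).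
  rewrite normcM normcV.
  have [->|tn0] := eqVneq (normc (z + al%:C%C)) 0.
    by rewrite mul0r powR0 // mulf_neq0 // gt_eqF.
  apply: ge1r_powR => //.
  have tp : 0 < normc (z + al%:C%C) by rewrite lt_neqAle eq_sym tn0 normc_ge0.
  by rewrite divr_gt0 //= ler_pdivrMr // mul1r.
set N := normc z ^+ 2 in z2 nza n1E *.
set t := normc (z + al%:C%C) in nza tle1 tk *; set l := normc (lin al z) in n1 n1E tle1 tk *.
apply: le_lt_trans (_ : a * (t * l) + (1 - a) * (1 - a * al ^+ 2) * N < _).
  rewrite lerD2r -mulrA; apply: ler_wpM2l; first by case/andP: a01.
  have -> : t * l = t / l * l ^+ 2 by field; rewrite gt_eqF.
  by apply: ler_wpM2r; [exact: sqr_ge0|exact: tk].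
apply: le_lt_trans (_ : a * ((t ^+ 2 + l ^+ 2) / 2) + (1 - a) * (1 - a * al ^+ 2) * N < _).
  rewrite lerD2r; apply: ler_wpM2l; first by case/andP: a01.
  by have := sqr_ge0 (t - l); rewrite sqrrB => ?; lra.
rewrite nza n1E sqr_normc_lin -/N -subr_gt0.
set x := complex.Re z.
have -> : 1 + 2 * (a * al) * x + (a * al) ^+ 2 * N -
   (a * ((N + 2 * al * x + al ^+ 2 + (1 + 2 * al * x + al ^+ 2 * N)) / 2) +
    (1 - a) * (1 - a * al ^+ 2) * N) = (1 - N) * (1 - a * (1 + al ^+ 2) / 2) by field.
apply: mulr_gt0; lra.
Qed.
End lower.

(** * Support inequalities: the indicatrix from outside *)

Section upper.
Variables (R : realType) (m b : R).
Hypothesis m12 : 1 / 2 <= m.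
Let m0 : 0 < m. Proof. exact: half_le_gt0. Qed.
Let k1 : 1 <= 2 * m. Proof. exact: half_le_mul2. Qed.
Local Notation k := (2 * m).
Local Notation I := (kobayashi_indicatrix (ellipsoid m) ((b%:C%C, 0) : C2 R)).

(** This tangent inequality is the convexity of the ellipsoid, and the place
    where [m >= 1/2] matters for the upper bound. *)
Lemma bernoulli_powR (t : R) : 0 <= t -> 1 + k * (t - 1) <= t `^ k.
Proof.
rewrite le_eqVlt => /predU1P[<-|t0].
  by rewrite powR0 ?mulf_neq0 ?gt_eqF //; have h := k1; lra.
(* [t ^ (2 m) = t * exp ((2 m - 1) ln t)], [exp u >= 1 + u] and
   [ln t >= 1 - 1/t]. *)
have lnt : 1 - t^-1 <= ln t.
  have : ln (1 + (t^-1 - 1)) <= t^-1 - 1.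
    by apply: le_ln1Dx; rewrite ltrBDr addrC subrr invr_gt0.
  have -> : 1 + (t^-1 - 1) = t^-1 by ring.
  by rewrite lnV ?posrE // => ?; lra.
have -> : t `^ k = t * t `^ (k - 1) by rewrite mulr_powRB1 ?ltW // mulr_gt0.
have h : 1 + (k - 1) * (1 - t^-1) <= t `^ (k - 1).
  apply: le_trans (_ : 1 + (k - 1) * ln t <= _).
    by rewrite lerD2l ler_wpM2l // subr_ge0.
  by rewrite /powR gt_eqF // expR_ge1Dx.
apply: le_trans (ler_wpM2l (ltW t0) h).
by rewrite le_eqVlt; apply/orP; left; apply/eqP; field; rewrite gt_eqF.
Qed.

Lemma unit_inv (z : R[i]) : normc z = 1 -> z^-1 = (Complex (complex.Re z) (- complex.Im z)).
Proof.
move=> z1; have z0 : z != 0 by apply/eqP => E; move: z1; rewrite E normc0 => /eqP; rewrite eq_sym oner_eq0.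
have h := normc_sqrE z; rewrite z1 expr1n in h.
apply: (mulfI z0); rewrite divff //; apply/eqP; rewrite eq_complex.
rewrite cReM cImM !cReC !cImC; apply/andP; split; apply/eqP; last by rewrite /=; ring.
by rewrite /= h; ring.
Qed.

(** Pointwise on the unit circle: the pairing of a point [(u, v)] of the
    ellipsoid with the outer normal at the boundary point of the extremal disc is
    at most its value at that boundary point. Here [L = |1 + al z|],
    [D = |1 + a al z|] and [n1 = |psi z|]. *)
Lemma support_ineq (c a A2 L S D n1 u v : R) : 0 <= c -> a = c `^ k -> 0 <= u -> 0 <= v -> 0 <= L -> 0 < n1 -> 0 < D ->
  S = a * L ^+ 2 -> S + A2 ^+ 2 = D ^+ 2 -> n1 `^ k = L ^+ 2 / D ^+ 2 -> 0 < L ->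
  u `^ k + v ^+ 2 < 1 ->
  m * a / c * L ^+ 2 / n1 * u - m * S + A2 * D * v - A2 ^+ 2 <= 0.
Proof.
move=> c0 aE u0 v0 L0 n10 D0 SE SD nE L0' uv.
have h2 : A2 * D * v <= (A2 ^+ 2 + D ^+ 2 * v ^+ 2) / 2.
  by have := sqr_ge0 (A2 - D * v); rewrite sqrrB exprMn => ?; lra.
have S0 : 0 <= S by rewrite SE aE mulr_ge0 ?powR_ge0 // sqr_ge0.
have h1 : m * a / c * L ^+ 2 / n1 * u - m * S <= (D ^+ 2 * u `^ k - S) / 2.
  have [cE|cn0] := eqVneq c 0.
    have a00 : a = 0 by rewrite aE cE powR0 // mulf_neq0 // gt_eqF.
    rewrite SE a00 !mulr0 !mul0r subr0 mulr0 subr0 mulr_ge0 ?invr_ge0 //.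
    by rewrite mulr_ge0 ?sqr_ge0 // powR_ge0.
  have cp : 0 < c by rewrite lt_neqAle eq_sym cn0.
  pose t := u / (c * n1).
  have t0 : 0 <= t by rewrite divr_ge0 // mulr_ge0 // ltW.
  have -> : m * a / c * L ^+ 2 / n1 * u = m * S * t.
    by rewrite SE /t; field; rewrite !gt_eqF.
  have -> : D ^+ 2 * u `^ k = S * t `^ k.
    have uE : u = t * (c * n1) by rewrite /t divfK // mulf_neq0 // gt_eqF.
    have -> : u `^ k = (t * (c * n1)) `^ k by rewrite -uE.
    have cn1 : 0 <= c * n1 by rewrite mulr_ge0 // ltW.
    rewrite (powRM _ t0 cn1) (powRM _ c0 (ltW n10)) nE -aE SE.
    by field; rewrite gt_eqF.
  have := ler_wpM2l S0 (bernoulli_powR t0); rewrite mulrDr mulr1 => ?; lra.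
have h3 : D ^+ 2 * (u `^ k + v ^+ 2) <= D ^+ 2.
  by rewrite -[leRHS]mulr1 ler_wpM2l ?sqr_ge0 // ltW.
lra.
Qed.

Lemma le_of_scaled_le (K L : R) : (forall r, 0 < r < 1 -> r * K <= L) -> K <= L.
Proof.
move=> H; apply/ler_addgt0Pr => e e0.
have [K0|K0] := leP K 0.
  have h12 : 0 < (1 / 2 : R) < 1 by rewrite divr_gt0 //= ltr_pdivrMr // mul1r ltr1n.
  by have := H _ h12; lra.
(* This [r] makes [K - r K = e r <= e]. *)
pose r := K / (K + e).
have Ke : 0 < K + e by rewrite addr_gt0.
have := H r; rewrite divr_gt0 //= ltr_pdivrMr // mul1r ltrDl e0 => /(_ isT) h.
have h2 := h.
have : K - r * K <= e.
  have -> : K - r * K = e * r by rewrite /r; field; rewrite gt_eqF.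
  have rle : r <= 1 by rewrite /r ler_pdivrMr // mul1r lerDl ltW.
  by rewrite -[leRHS]mulr1 ler_wpM2l // ltW.
move=> ?; lra.
Qed.

(** Royden-Wong duality. Along the extremal disc, the outer normals extend,
    up to positive factors and a factor [z], to the holomorphic dual map
    [(A (1 + al z) kap(z) / psi(z), A2 (1 + a al z))], [A = m a / c]. Pairing it
    with the difference of a competing disc, shrunk by [r < 1] to be defined on
    the closed disc, and the extremal disc gives a function [E] with [E 0 = 0]
    and [Re (E z / z) <= 0] on the circle; hence [Re E'(0) <= 0], which is linear
    in the derivatives of the competitor. The affine factor [kap] is [al + z]
    when the extremal first component has no zero, and [1 + al z] when it has
    a Blaschke factor. *)
Lemma indicatrix_support (c al q0 q1 x y : R) :
  let a := c `^ k in let A2 := Num.sqrt ((1 - a) * (1 - a * al ^+ 2)) in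
  0 <= c -> a <= 1 -> 0 <= al < 1 -> q0 * b = c * al ->
  (forall z, normc z = 1 -> normc (q0%:C%C + q1%:C%C * z) = normc (lin al z)) ->
  I (x%:C%C, y%:C%C) ->
  m * a / c * q0 * x + A2 * y <=
    m * a * (1 + al ^+ 2) - b * (m * a / c) * (al * q0 + q1 - q0 * (al - a * al) / m) + A2 ^+ 2.
Proof.
move=> a A2 c0 a1 al01 q0b qn /indicatrixP [f [g [fg [f0 g0] df dg]]].
pose K := m * a * (1 + al ^+ 2) - b * (m * a / c) * (al * q0 + q1 - q0 * (al - a * al) / m) + A2 ^+ 2.
(* The competitor is [z |-> (f (r z), g (r z))], whose derivative is scaled by
   [r]; the inequality for all [r < 1] gives the one for [r = 1]. *)
suff H r : 0 < r < 1 -> r * (m * a / c * q0 * x + A2 * y) <= K by exact: le_of_scaled_le H.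
move=> /andP[r0 r1].
have a0 : 0 <= a by exact: powR_ge0.
have [al0 al1] := andP al01.
have aal : 0 <= a * al < 1.
  rewrite mulr_ge0 //=; apply: le_lt_trans al1.
  by rewrite ler_piMl.
have [aal0 aal1] := andP aal.
have lt1 z : normc z <= 1 -> `|al| * normc z < 1.
  by move=> z1; rewrite ger0_norm //; apply: le_lt_trans al1; rewrite ler_piMr.
have lt2 z : normc z <= 1 -> `|a * al| * normc z < 1.
  by move=> z1; rewrite ger0_norm //; apply: le_lt_trans aal1; rewrite ler_piMr.
have lin0 w : lin w 0 = 1 :> R[i] by rewrite /lin mulr0 addr0.
pose A := m * a / c.
pose psi := qroot m al (a * al).
pose kap z := q0%:C%C + q1%:C%C * z.
(* [E1 - E2 + E3 - E4] pairs the dual map with the competitor minus the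
   extremal disc; in [E2] and [E4] the extremal disc has cancelled out. *)
pose E1 z := A%:C%C * (lin al z * kap z * ((psi z)^-1 * f (r%:C%C * z))).
pose E2 z := (m * a)%:C%C * (lin al z * (z + al%:C%C)).
pose E3 z := A2%:C%C * (lin (a * al) z * g (r%:C%C * z)).
pose E4 z := (A2 ^+ 2)%:C%C * z.
pose E z := E1 z - E2 z + E3 z - E4 z.
have mulid (w z : R[i]) : cdiff (fun z => w * z) z w.
  by apply: cdiff_eq (cdiffM (cdiff_cst w z) (cdiff_id z)) _; rewrite mulr0 addr0 mulr1.
have cstM (w : R[i]) h z d : cdiff h z d -> cdiff (fun z => w * h z) z (w * d).
  by move=> hd; apply: cdiff_eq (cdiffM (cdiff_cst w z) hd) _; rewrite mulr0 addr0.
have dkap z : cdiff kap z q1%:C%C.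
  by apply: cdiff_eq (cdiffD (cdiff_cst q0%:C%C z) (mulid q1%:C%C z)) _; rewrite add0r.
have dsh z : cdiff (fun z => z + al%:C%C) z 1.
  by apply: cdiff_eq (cdiffD (cdiff_id z) (cdiff_cst al%:C%C z)) _; rewrite addr0.
have dE z dp df' dg' : cdiff psi z dp -> cdiff f (r%:C%C * z) df' -> cdiff g (r%:C%C * z) dg' ->
  cdiff E z (A%:C%C * (lin al z * kap z * ((psi z)^-1 * (df' * r%:C%C) + f (r%:C%C * z) * (- psi z ^- 2 * dp)) +
     (psi z)^-1 * f (r%:C%C * z) * (lin al z * q1%:C%C + kap z * al%:C%C)) -
    (m * a)%:C%C * (lin al z * 1 + (z + al%:C%C) * al%:C%C) +
    A2%:C%C * (lin (a * al) z * (dg' * r%:C%C) + g (r%:C%C * z) * (a * al)%:C%C) - (A2 ^+ 2)%:C%C).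
  move=> hp hf hg.
  have hfr := cdiff_comp hf (mulid r%:C%C z).
  have hgr := cdiff_comp hg (mulid r%:C%C z).
  have h1 := cstM A%:C%C _ _ _ (cdiffM (cdiffM (cdiff_lin al z) (dkap z))
     (cdiffM (cdiffV (qroot_neq0 m al (a * al) z) hp) hfr)).
  have h2 := cstM (m * a)%:C%C _ _ _ (cdiffM (cdiff_lin al z) (dsh z)).
  have h3 := cstM A2%:C%C _ _ _ (cdiffM (cdiff_lin (a * al) z) hgr).
  have h4 := mulid (A2 ^+ 2)%:C%C z.
  exact: (cdiffB (cdiffD (cdiffB h1 h2) h3) h4).
have rz z : normc z <= 1 -> normc (r%:C%C * z) < 1.
  move=> z1; rewrite normcM normc_real gtr0_norm //; apply: le_lt_trans r1.
  by rewrite ler_piMr // ltW.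
have A0E : a = 0 -> A = 0 by move=> ae; rewrite /A ae mulr0 mul0r.
have qb : A * q0 * b = m * a * al.
  rewrite -mulrA q0b /A; have [cE|cn0] := eqVneq c 0; last by field.
  by rewrite /a cE powR0 ?mulf_neq0 ?gt_eqF // mulr0 !mul0r.
have hp0 := cdiff_qroot m (lt1 0 _) (lt2 0 _).
have n0 : normc (0 : R[i]) <= 1 by rewrite normc0.
have {}hp0 := hp0 n0 n0.
have dE0 := dE 0 _ _ _ hp0.
rewrite mulr0 in dE0; have {}dE0 := dE0 _ _ df dg.
set D0 := (X in cdiff E 0 X) in dE0.
have D0E : D0 = (r * (m * a / c * q0 * x + A2 * y) - K)%:C%C.
  rewrite /D0 /K -/A !lin0 /kap mulr0 addr0 add0r /psi qroot0 f0 g0 !expr1n !invr1.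
  rewrite !(rmorphM, rmorphD, rmorphB, rmorphXn, rmorph1, rmorphN) /=.
  ring.
have E00 : E 0 = 0.
  rewrite /E /E1 /E2 /E3 /E4 !mulr0 !lin0 /kap mulr0 addr0 add0r /psi qroot0 f0 g0 invr1 !mul1r !mulr0.
  by rewrite addr0 subr0 -!rmorphM -rmorphB /= mulrA qb subrr.
suff : complex.Re D0 <= 0 by rewrite D0E cReR subr_le0.
apply: (schwarz_max E00 dE0).
  move=> z z1; have [[d1 h1] [d2 h2] _] := fg _ (rz z z1).
  by eexists; exact: dE (cdiff_qroot m (lt1 z z1) (lt2 z z1)) h1 h2.
move=> z z1.
have z1' : normc z <= 1 by rewrite z1.
have [_ _ inO] := fg _ (rz z z1').
set F := f (r%:C%C * z) in inO; set G := g (r%:C%C * z) in inO.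
have uv : normc F `^ k + normc G ^+ 2 < 1 by exact: inO.
have zn0 : z != 0 by apply/eqP => zE; move: z1; rewrite zE normc0 => /eqP; rewrite eq_sym oner_eq0.
have L0 : 0 < normc (lin al z) by rewrite normc_gt0 // Re_gt0_neq0 // Re_lin_gt0 // lt1.
have D0' : 0 < normc (lin (a * al) z) by rewrite normc_gt0 // Re_gt0_neq0 // Re_lin_gt0 // lt2.
have P0 : 0 < normc (psi z) by rewrite normc_gt0 // qroot_neq0.
have A2E : A2 ^+ 2 = (1 - a) * (1 - a * al ^+ 2).
  by rewrite sqr_sqrtr // sqrt_factor_ge0 // ?a0 // al0 ltW.
have SD : a * normc (lin al z) ^+ 2 + A2 ^+ 2 = normc (lin (a * al) z) ^+ 2.
  by rewrite A2E !sqr_normc_lin z1; ring.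
have PE : normc (psi z) `^ k = normc (lin al z) ^+ 2 / normc (lin (a * al) z) ^+ 2.
  by apply: normc_qroot; rewrite ?lt1 ?lt2.
refine (le_trans _ (support_ineq c0 erefl (normc_ge0 F) (normc_ge0 G) (ltW L0) P0 D0' erefl SD PE L0 uv)).
have re_le (w : R[i]) : complex.Re w <= normc w by exact: le_trans (ler_norm _) (normc_re w).
have -> : E z / z = E1 z / z - E2 z / z + E3 z / z - (A2 ^+ 2)%:C%C.
  by rewrite /E /E4; field.
rewrite !(cReB, cReD) cReR; apply: lerD => //; apply: lerD; first apply: lerD.
- apply: le_trans (re_le _) _; rewrite /E1 !normcM !normcV z1 qn // normc_real.
  rewrite ger0_norm; last by rewrite /A !mulr_ge0 ?invr_ge0 // ltW.
  rewrite -/F le_eqVlt; apply/orP; left; apply/eqP; rewrite /A divr1 -/a; ring.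
- rewrite lerN2 le_eqVlt; apply/orP; left; apply/eqP.
  rewrite /E2 (unit_inv z1) sqr_normc_lin z1.
  have h := normc_sqrE z; rewrite z1 expr1n in h.
  rewrite !(cReM, cImM) cReR cImR Re_lin Im_lin cReD cImD cReR cImR cReC cImC.
  rewrite -/a; set X := complex.Re z; set Y := complex.Im z.
  have Y2 : Y ^+ 2 = 1 - X ^+ 2 by rewrite h /X /Y; ring.
  transitivity (m * a * ((1 + al * X) * (X + al) * X + (1 + al * X + al ^+ 2) * Y ^+ 2)).
    by rewrite Y2; ring.
  by ring.
- apply: le_trans (re_le _) _; rewrite /E3 !normcM !normcV z1 normc_real ger0_norm ?sqrtr_ge0 //.
  by rewrite invr1 mulr1 mulrA.
Qed.

Lemma le_sqrt_sqr (A2 y : R) : 0 <= y -> 0 < A2 -> A2 * y <= A2 ^+ 2 -> y ^+ 2 <= A2 ^+ 2.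
Proof. by move=> y0 A20; rewrite expr2 ler_pM2l // => h; rewrite -expr2 ler_pXn2r ?nnegrE // ltW. Qed.

Lemma indicatrix_below_arc0 (p x y : R) : 0 <= b < 1 -> 0 <= p < 1 -> 0 <= y ->
  I (x%:C%C, y%:C%C) -> b / m * p * (1 - b `^ k) <= x ->
  y ^+ 2 <= (1 - b `^ k) * (1 - b `^ k * p ^+ 2).
Proof.
move=> /andP[b0 b1] /andP[p0 p1] y0 hI hx; set a := b `^ k in hx *.
have a1 : a < 1 by apply: powR_lt1; rewrite ?b0 // mulr_gt0.
have a0 : 0 <= a by exact: powR_ge0.
have Y0 : 0 < (1 - a) * (1 - a * p ^+ 2).
  rewrite mulr_gt0 ?subr_gt0 //; apply: le_lt_trans a1.
  by rewrite ler_piMr // exprn_ile1 // ltW.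
have := @indicatrix_support b p p 1 x y b0 (ltW a1).
rewrite p0 p1 mulrC => /(_ isT erefl).
have circ (z : R[i]) : normc z = 1 -> normc (p%:C%C + 1%:C%C * z) = normc (lin p z).
  move=> z1; apply/eqP; rewrite -(@eqrXn2 _ 2) ?normc_ge0 //.
  apply/eqP; rewrite sqr_normc_lin z1 [LHS]normc_sqrE cReD cImD cReM cImM !cReR !cImR.
  have h := normc_sqrE z; rewrite z1 in h.
  transitivity (p ^+ 2 + 2 * p * complex.Re z + (complex.Re z ^+ 2 + complex.Im z ^+ 2)).
    by ring.
  by rewrite -h; ring.
move=> /(_ circ hI); rewrite -/a.
set A2 := Num.sqrt _ => h.
have A2E : A2 ^+ 2 = (1 - a) * (1 - a * p ^+ 2) by rewrite sqr_sqrtr // ltW.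
rewrite -A2E; apply: le_sqrt_sqr => //; first by rewrite sqrtr_gt0.
rewrite -(lerD2l (m * a / b * p * x)); apply: le_trans h _.
rewrite lerD2r.
have [bE|bn0] := eqVneq b 0.
  have aE : a = 0 by rewrite /a bE powR0 // mulf_neq0 // gt_eqF.
  by rewrite aE bE !mulr0 !mul0r subr0.
have bp : 0 < b by rewrite lt_neqAle eq_sym bn0.
have := ler_wpM2l _ hx => /(_ (m * a / b * p)).
have nn : 0 <= m * a / b * p by rewrite !mulr_ge0 ?invr_ge0 // ltW.
move=> /(_ nn); apply: le_trans; rewrite le_eqVlt; apply/orP; left; apply/eqP.
by field; rewrite !gt_eqF.
Qed.

Local Notation xcurve := (xcurve m b).
Local Notation ycurve := (ycurve m b).

Lemma indicatrix_support_arc1 (c x y : R) : 0 <= b -> 0 < c -> b < c <= 1 ->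
  I (x%:C%C, y%:C%C) ->
  m * c `^ k / c * x + Num.sqrt (ycurve c) * y <=
  m * c `^ k / c * xcurve c + ycurve c.
Proof.
move=> b0 c0 /andP[bc c1] hI; rewrite /ycurve /xcurve; set a := c `^ k.
have a1 : a <= 1 by apply: powR_le1; rewrite ?(ltW c0) // mulr_ge0 // ltW.
have a0 : 0 <= a by exact: powR_ge0.
have al0 : 0 <= b / c by rewrite divr_ge0 // ltW.
have al1 : b / c < 1 by rewrite ltr_pdivrMr // mul1r.
have := @indicatrix_support c (b / c) 1 (b / c) x y (ltW c0) a1.
rewrite al0 al1 mul1r [c * _]mulrC divfK ?gt_eqF // => /(_ isT erefl).
rewrite -/a => /(_ (fun z _ => erefl) hI).
rewrite mulr1 => /le_trans; apply.
rewrite sqr_sqrtr; last by rewrite sqrt_factor_ge0 // ?a0 // al0 ltW.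
rewrite lerD2r le_eqVlt; apply/orP; left; apply/eqP.
by field; rewrite !gt_eqF.
Qed.

Lemma indicatrix_below_arc1 (c x y : R) : 0 <= b -> 0 < c -> b < c < 1 -> 0 <= y ->
  I (x%:C%C, y%:C%C) -> xcurve c <= x -> y ^+ 2 <= ycurve c.
Proof.
move=> b0 c0 /andP[bc c1] y0 hI hx.
have := indicatrix_support_arc1 b0 c0 _ hI; rewrite bc (ltW c1) => /(_ isT) h.
have a1 : c `^ k < 1 by apply: powR_lt1; rewrite ?(ltW c0) // mulr_gt0.
have a0 : 0 <= c `^ k by exact: powR_ge0.
have Y0 : 0 < ycurve c.
  rewrite mulr_gt0 ?subr_gt0 //; apply: le_lt_trans a1.
  rewrite ler_piMr // exprn_ile1 // ?divr_ge0 // ?(ltW c0) //.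
  by rewrite ler_pdivrMr // mul1r ltW.
have YE : Num.sqrt (ycurve c) ^+ 2 = ycurve c by rewrite sqr_sqrtr // ltW.
apply: le_trans (_ : Num.sqrt (ycurve c) ^+ 2 <= _); last by rewrite YE.
apply: le_sqrt_sqr => //; first by rewrite sqrtr_gt0.
rewrite YE -(lerD2l (m * c `^ k / c * x)); apply: le_trans h _.
by rewrite lerD2r ler_wpM2l // !mulr_ge0 ?invr_ge0 // ltW.
Qed.

(** The arc ends at [c = 1], where the second coefficient of the support
    functional vanishes. *)
Lemma indicatrix_width (x y : R) : 0 <= b < 1 -> I (x%:C%C, y%:C%C) -> x <= 1 - b ^+ 2.
Proof.
move=> /andP[b0 b1] hI; have := indicatrix_support_arc1 b0 ltr01 _ hI.
rewrite b1 lexx => /(_ isT).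
rewrite /ycurve /xcurve powR1 subrr !mul0r sqrtr0 mul0r !addr0 mulr0 mul0r addr0 mulr1 !divr1 mul1r.
by rewrite ler_pM2l.
Qed.

End upper.

(** * Areas of discs *)

Section disc_area.
Variable R : realType.
Notation mu := (@lebesgue_measure R).

Lemma is_derive_continuous (f : R -> R) (x d : R) :
  is_derive (x : R) (1 : R) f d -> {for x, continuous f}.
Proof. by move=> [df _]; apply/differentiable_continuous/derivable1_diffP. Qed.

Lemma is_derive_LRcontinuous (F f : R -> R) (a b : R) :
  (forall x, is_derive (x : R) (1 : R) F (f x)) -> derivable_oo_LRcontinuous F a b.
Proof.
move=> dF; split; first by move=> x _; case: (dF x).
  by apply: cvg_at_right_filter; exact: is_derive_continuous (dF a).
by apply: cvg_at_left_filter; exact: is_derive_continuous (dF b).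
Qed.

Lemma is_derive_derive1 (F f : R -> R) :
  (forall x, is_derive (x : R) (1 : R) F (f x)) -> derive1 F = f.
Proof. by move=> dF; apply/funext => x; rewrite derive1E; case: (dF x). Qed.

Lemma half_disc_integral (r : R) : 0 < r ->
  (\int[mu]_(x in `[(- r)%R, r]) (2 * Num.sqrt (r ^+ 2 - x ^+ 2))%:E = (pi * r ^+ 2)%:E)%E.
Proof.
move=> r0.
(* Substitution [x = r sin t]. *)
pose F t := r * sin t; pose G x := 2 * Num.sqrt (r ^+ 2 - x ^+ 2).
have p0 : 0 < pi / 2 :> R by rewrite divr_gt0 // pi_gt0.
have pN : - (pi / 2) < pi / 2 :> R by rewrite gtrN.
have dF t : is_derive (t : R) (1 : R) F (r * cos t).
  by rewrite /F; apply: is_derive_eq; rewrite /GRing.scale /=; ring.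
have FE := is_derive_derive1 dF.
have ccos : continuous (fun t : R => r * cos t).
  move=> t; have h : is_derive (t : R) (1 : R) (fun t => r * cos t) (- (r * sin t)).
    by apply: is_derive_eq; rewrite /GRing.scale /=; ring.
  exact: is_derive_continuous h.
have Fr : F (pi / 2) = r by rewrite /F sin_pihalf mulr1.
have Fl : F (- (pi / 2)) = - r by rewrite /F sinN sin_pihalf mulrN1.
have := @integration_by_substitution_increasing _ F G (- (pi / 2)) (pi / 2) (ltW pN).
rewrite Fr Fl => ->.
- rewrite FE.
  pose H t : R := r ^+ 2 * (t + sin t * cos t).
  pose h t : R := 2 * r ^+ 2 * cos t ^+ 2.
  have dH (t : R) : is_derive (t : R) (1 : R) H (h t).
    rewrite /H /h; apply: is_derive_eq; rewrite /GRing.scale /=.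
    have := sin2cos2 t => s2.
    transitivity (r ^+ 2 * (1 + cos t ^+ 2 - sin t ^+ 2)); first by ring.
    by rewrite s2; ring.
  have dh (t : R) : is_derive (t : R) (1 : R) h (- (4 * r ^+ 2 * cos t * sin t)).
    by rewrite /h; apply: is_derive_eq; rewrite /GRing.scale /=; ring.
  transitivity (\int[mu]_(x in `[(- (pi / 2))%R, (pi / 2)%R]) (h x)%:E)%E.
    apply: eq_integral => t; rewrite inE /= in_itv /= => /andP[t1 t2].
    congr (_%:E); rewrite /h /G /F /=.
    have c0 : 0 <= cos t by apply: cos_ge0_pihalf; rewrite t1 t2.
    rewrite fctE /= exprMn.
    have -> : r ^+ 2 - r ^+ 2 * sin t ^+ 2 = (r * cos t) ^+ 2.
      by rewrite exprMn cos2sin2; ring.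
    by rewrite sqrtr_sqr ger0_norm ?mulr_ge0 // ?(ltW r0) //; ring.
  rewrite (@continuous_FTC2 _ h H) //.
  + rewrite /H sinN cosN sin_pihalf cos_pihalf !mulr0 !addr0 -EFinB.
    by congr (_%:E); field.
  + apply: continuous_subspaceT => t; exact: is_derive_continuous (dh t).
  + exact: is_derive_LRcontinuous dH.
  + by move=> t _; rewrite (is_derive_derive1 dH).
- move=> s t sI tI st; rewrite /F ltr_pM2l // ltr_sin //.
- by move=> t _; rewrite FE; exact: ccos.
- rewrite FE; apply: cvgP; apply: cvg_at_right_filter; exact: ccos.
- rewrite FE; apply: cvgP; apply: cvg_at_left_filter; exact: ccos.
- exact: is_derive_LRcontinuous dF.
- apply: continuous_subspaceT => x; rewrite /G.
  have h : is_derive (x : R) (1 : R) (fun x : R => r ^+ 2 - x ^+ 2) (- (2 * x)).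
    by apply: is_derive_eq; rewrite /GRing.scale /=; ring.
  apply: cvgM; first exact: cvg_cst.
  apply: (continuous_comp (f := fun x : R => r ^+ 2 - x ^+ 2) (g := @Num.sqrt R)).
    exact: is_derive_continuous h.
  exact: sqrt_continuous.
Qed.

Definition sqn (X : R * R) : R := X.1 ^+ 2 + X.2 ^+ 2.

Lemma lebesgue_measure_sqr_lt (s : R) : 0 <= s ->
  mu [set y | y ^+ 2 < s] = (2 * Num.sqrt s)%:E.
Proof.
move=> s0.
have E y : (y ^+ 2 < s) = (`|y| < Num.sqrt s).
  rewrite -[X in _ < X](sqr_sqrtr s0) -(real_normK (num_real y)).
  by rewrite ltr_pXn2r ?nnegrE ?sqrtr_ge0.
have -> : [set y : R | y ^+ 2 < s] = `](- Num.sqrt s), Num.sqrt s[%classic.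
  by apply/seteqP; split => y /=; rewrite in_itv /= -ltr_norml E.
rewrite lebesgue_measure_itv /= lte_fin; case: ltP => h.
  by rewrite -EFinD; congr (_%:E); ring.
have : Num.sqrt s = 0 by apply/eqP; rewrite eq_le sqrtr_ge0 andbT; have := sqrtr_ge0 s; lra.
by move=> ->; rewrite mulr0.
Qed.

Lemma open_disc_area (s : R) :
  (mu \x mu)%E [set X | sqn X < s] = (if 0 <= s then pi * s else 0)%:E.
Proof.
rewrite /product_measure1 /=.
case: ifP => s0; last first.
  apply: integral0_eq => x _ /=.
  have -> : xsection [set X | sqn X < s] x = set0.
    rewrite predeqE => y; split => //; rewrite /xsection /= inE /sqn /=.
    have := sqr_ge0 x; have := sqr_ge0 y; move/negbT: s0; rewrite -ltNge; lra.
  by rewrite measure0.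
have xs x : xsection [set X | sqn X < s] x = [set y | y ^+ 2 < s - x ^+ 2].
  by apply/seteqP; split => y; rewrite /xsection /= inE /sqn /= ltrBrDl.
transitivity (\int[mu]_(x in `[(- Num.sqrt s)%R, (Num.sqrt s)%R]) (2 * Num.sqrt (s - x ^+ 2))%:E)%E.
  rewrite [RHS]integral_mkcond; apply: eq_integral => x _ /=.
  rewrite xs patchE.
  have memE : (x \in `[(- Num.sqrt s)%R, (Num.sqrt s)%R]%classic) = (x ^+ 2 <= s).
    rewrite mem_setE in_itv /= -ler_norml -[in RHS](sqr_sqrtr s0) -(real_normK (num_real x)).
    by rewrite ler_pXn2r ?nnegrE ?sqrtr_ge0.
  rewrite memE; case: ifP => h; first by rewrite lebesgue_measure_sqr_lt // subr_ge0.
  have -> : [set y : R | y ^+ 2 < s - x ^+ 2] = set0.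
    rewrite predeqE => y; split => //=; have := sqr_ge0 y.
    by move/negbT: h; rewrite -ltNge; lra.
  by rewrite measure0.
move: s0; rewrite le_eqVlt => /predU1P[<-|s0].
  by rewrite sqrtr0 oppr0 set_itv1 integral_set1 mulr0.
have := @half_disc_integral (Num.sqrt s); rewrite sqrtr_gt0 s0 => /(_ isT).
by rewrite sqr_sqrtr ?ltW.
Qed.
End disc_area.

(** * Radial integrals *)

Section radial.
Variable R : realType.
Notation mu := (@lebesgue_measure R).
Notation TR := (measurableTypeR R).

Lemma measurable_sqn : measurable_fun setT (@sqn R : TR * TR -> TR).
Proof.
apply: measurable_funD; apply: measurable_funX.
  exact: measurable_fst.
exact: measurable_snd.
Qed.

(** [X |-> |X| ^ 2] maps the plane measure to [pi] times the Lebesgue measure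
    of the half-line: both measures agree on the half-lines [s < x], which
    generate the Borel sets. *)
Lemma pushforward_sqn (A : set TR) : measurable A ->
  (mu \x mu)%E (@sqn R @^-1` A) = (pi%:E * mu (A `&` `[0%R, +oo[))%E.
Proof.
move=> mA.
have pi0 : (0 : R) <= pi by exact: pi_ge0.
pose m2 : {measure set TR -> \bar R} :=
  mscale (NngNum pi0) (mrestr mu (measurable_itv `[(0 : R), +oo[)).
have [m1 m1E] : exists m1 : {measure set TR -> \bar R},
    forall B, m1 B = (mu \x mu)%E (@sqn R @^-1` B).
  unshelve eexists (pushforward (mu \x mu)%E (@sqn R : TR * TR -> TR) : {measure set _ -> \bar _}).
    exact: measurable_sqn.
  by [].
rewrite -[RHS]/(m2 A) -m1E.
pose g n : set TR := `]-oo, (n%:R : R)[%classic.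
have ev1 (x : R) : m1 `]-oo, x[%classic = (if 0 <= x then pi * x else 0)%:E.
  rewrite m1E -open_disc_area.
  have -> : @sqn R @^-1` `]-oo, x[%classic = [set X | sqn X < x] by
    apply/seteqP; split => X /=; rewrite in_itv.
  by [].
have ev2 (x : R) : m2 `]-oo, x[%classic = (if 0 <= x then pi * x else 0)%:E.
  have sE : `]-oo, x[ `&` `[0%R, +oo[ = `[0%R, x[%classic :> set R.
    apply/seteqP; split => y /=; rewrite !in_itv /= andbT; first by move=> [-> ->].
    by move=> /andP[-> ->].
  have -> : m2 `]-oo, x[%classic = (pi%:E * mu `[0%R, x[%classic)%E by rewrite -sE.
  rewrite lebesgue_measure_itv /= lte_fin.
  case: ltP => h; first by rewrite ltW // oppr0 adde0.
  have -> : (if 0 <= x then pi * x else 0) = 0.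
    case: ifP => // h2; have -> : x = 0 by apply/eqP; rewrite eq_le h h2.
    by rewrite mulr0.
  by rewrite mule0.
have Gm : @RGenInftyO.G R `<=` (measurable : set (set TR)).
  by move=> B [x ->]; exact: measurable_itv.
have Gg i : @RGenInftyO.G R (g i) by exists i%:R.
have gT : \bigcup_i g i = [set: TR].
  apply/seteqP; split => // x _; exists (Num.truncn `|x|).+1 => //; rewrite /g /=.
  rewrite in_itv /=; apply: le_lt_trans (ler_norm x) _; exact: truncnS_gt.
have GI : setI_closed (@RGenInftyO.G R).
  move=> B C [x ->] [y ->]; exists (Num.min x y).
  apply/seteqP; split => z /=; rewrite !in_itv /= lt_min; first by move=> [-> ->].
  by move=> /andP[-> ->].
have m12 B : @RGenInftyO.G R B -> m1 B = m2 B by move=> [x ->]; rewrite ev1 ev2.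
have fin i : (m1 (g i) < +oo)%E by rewrite ev1 ltry.
apply: (@g_sigma_algebra_measure_unique _ R TR _ Gm g Gg gT m1 m2 GI m12 fin).
by move: mA; rewrite [X in X A -> _]RGenInftyO.measurableE.
Qed.

Lemma radial_integral (g : R -> \bar R) :
  measurable_fun setT (g : TR -> \bar R) -> (forall x, 0 <= g x)%E ->
  (\int[mu \x mu]_X g (sqn X) = pi%:E * \int[mu]_(s in `[0%R, +oo[) g s)%E.
Proof.
move=> mg g0.
have pi0 : (0 : R) <= pi by exact: pi_ge0.
have mD : measurable (`[(0 : R), +oo[%classic : set TR) by exact: measurable_itv.
have mgD : measurable_fun (`[(0 : R), +oo[%classic : set TR) g by exact: measurable_funTS.
have := @ge0_integral_pushforward _ _ _ _ R _ measurable_sqn (mu \x mu)%E _ g mD mgD (fun y _ => g0 y).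
have -> : @sqn R @^-1` `[0%R, +oo[ = setT.
  by apply/seteqP; split => // X _ /=; rewrite in_itv /= andbT addr_ge0 // sqr_ge0.
move=> <-; transitivity (\int[mscale (NngNum pi0) mu]_(x in `[0%R, +oo[) g x)%E.
  apply: eq_measure_integral => [|mf A mA AD]; first exact: measurable_sqn.
  rewrite -[LHS]/((mu \x mu)%E (@sqn R @^-1` A)) pushforward_sqn //.
  by rewrite setIidl.
by rewrite ge0_integral_mscale.
Qed.
End radial.

(** * Volume of a Reinhardt set *)

Section reinhardt_volume.
Variable R : realType.
Notation mu := (@lebesgue_measure R).
Notation TR := (measurableTypeR R).

Lemma closed_disc_area (s : R) : 0 <= s ->
  (mu \x mu)%E [set X | sqn X <= s] = (pi * s)%:E.
Proof.
move=> s0.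
have -> : [set X | sqn X <= s] = @sqn R @^-1` `]-oo, s]%classic.
  by apply/seteqP; split => X /=; rewrite in_itv.
rewrite pushforward_sqn; last exact: measurable_itv.
have -> : `]-oo, s] `&` `[0%R, +oo[ = `[0%R, s]%classic :> set R.
  apply/seteqP; split => y /=; rewrite !in_itv /= andbT; first by move=> [-> ->].
  by move=> /andP[-> ->].
rewrite lebesgue_measure_itv /= lte_fin; move: s0; rewrite le_eqVlt => /predU1P[<-|->].
  by rewrite ltxx mule0 mulr0.
by rewrite oppr0 adde0.
Qed.

Lemma sqn_normc (X : R * R) : sqn X = normc (Complex X.1 X.2) ^+ 2.
Proof. by rewrite normc_sqrE. Qed.

(** The product measure of a set is by definition the integral of the measures
    of its slices; here the slice over [X1] is a disc of area
    [pi F(|X1| ^ 2)]. *)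
Lemma reinhardt_volume (A : set (C2 R)) (s1 : R) (F : R -> R) :
  measurable_fun (`[0%R, s1]%classic : set TR) (F : TR -> R) ->
  (forall s, 0 <= s <= s1 -> 0 <= F s) ->
  (forall X1 X2 : R[i], A (X1, X2) <->
     normc X1 ^+ 2 <= s1 /\ normc X2 ^+ 2 <= F (normc X1 ^+ 2)) ->
  lebesgue_measure_C2 A = ((pi ^+ 2)%:E * \int[mu]_(s in `[0%R, s1]) (F s)%:E)%E.
Proof.
move=> mF F0 AE.
pose g : R -> \bar R := (fun s => (pi * F s)%:E) \_ `[0%R, s1]%classic.
have mI : measurable (`[0%R, s1]%classic : set TR) by exact: measurable_itv.
have mg : measurable_fun setT (g : TR -> \bar R).
  apply/(measurable_restrictT _ mI); apply/measurable_EFinP.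
  by apply: measurable_funM => //; exact: measurable_cst.
have g0 s : (0 <= g s)%E.
  rewrite /g patchE; case: ifPn => // sI.
  rewrite lee_fin mulr_ge0 ?pi_ge0 // F0 //.
  by move: sI; rewrite mem_setE in_itv.
rewrite /lebesgue_measure_C2 /= {1}/product_measure1.
transitivity (\int[mu \x mu]_X g (sqn X))%E.
  apply: eq_integral => X _ /=.
  have sq0 : 0 <= sqn X by rewrite addr_ge0 // sqr_ge0.
  rewrite /g patchE mem_setE in_itv /= sq0 /=.
  case: ifP => hX.
    rewrite -closed_disc_area; last by rewrite F0 // sq0.
    congr (_ _); apply/seteqP; split => Y; rewrite /xsection /= inE /= /C2_of_R4 /=.
      by move=> /AE [_]; rewrite -!sqn_normc.
    by move=> hY; apply/AE; rewrite -!sqn_normc.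
  have -> : xsection (@C2_of_R4 R @^-1` A) X = set0.
    rewrite predeqE => Y; split => //; rewrite /xsection /= inE /= /C2_of_R4 /=.
    by move=> /AE [+ _]; rewrite -sqn_normc hX.
  by rewrite measure0.
rewrite radial_integral // expr2 EFinM -muleA; congr (_ * _)%E.
transitivity (\int[mu]_(s in `[0%R, s1]) (pi * F s)%:E)%E.
  rewrite /g -integral_mkcondr; congr (integral _ _ _).
  apply/seteqP; split => y /=; rewrite !in_itv /= andbT; first by move=> [_ ->].
  by move=> /andP[-> ->].
under eq_integral do rewrite EFinM.
rewrite ge0_integralZl //=.
- exact/measurable_EFinP.
- by rewrite lee_fin; exact: pi_ge0.
Qed.
End reinhardt_volume.

(** * The second arc as a graph *)

Section profile_curve.
Variables (R : realType) (m b : R).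
Hypothesis m12 : 1 / 2 <= m.
Hypothesis b01 : 0 <= b < 1.
Let m0 : 0 < m. Proof. exact: half_le_gt0. Qed.
Let k1 : 1 <= 2 * m. Proof. exact: half_le_mul2. Qed.
Let b0 : 0 <= b. Proof. by case/andP: b01. Qed.
Let b1 : b < 1. Proof. by case/andP: b01. Qed.
Local Notation k := (2 * m).
Local Notation xc := (xcurve m b).
Local Notation yc := (ycurve m b).
Notation mu := (@lebesgue_measure R).

Lemma is_derive_powk (c : R) : 0 < c ->
  is_derive (c : R) (1 : R) (fun c : R => c `^ k) (k * c `^ k / c).
Proof.
move=> c0; have h := is_derive1_powR k c0.
apply: is_derive_eq h _.
by rewrite -(mulr_powRB1 (ltW c0) (p := k)) ?mulr_gt0 //; field; rewrite gt_eqF.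
Qed.

Lemma is_derive_quot (c : R) : 0 < c ->
  is_derive (c : R) (1 : R) (fun c : R => b / c) (- (b / c ^+ 2)).
Proof.
move=> c0; have cn0 : c != 0 by rewrite gt_eqF.
have dV : is_derive (c : R) (1 : R) (fun x : R => x^-1) (- c ^- 2 *: 1).
  exact: (@is_deriveV _ id).
apply: (is_derive_eq (is_deriveZ b dV)).
by rewrite /GRing.scale /=; field.
Qed.

Definition dxcurve (c : R) :=
  1 + (b / c) ^+ 2 - (b / c) ^+ 2 / m * (1 + (k - 1) * c `^ k).

Lemma is_derive_xcurve (c : R) : 0 < c -> is_derive (c : R) (1 : R) xc (dxcurve c).
Proof.
move=> c0; have dp := is_derive_powk c0; have du := is_derive_quot c0.
rewrite /xcurve /dxcurve; apply: is_derive_eq; rewrite /GRing.scale /=.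
by field; rewrite !gt_eqF.
Qed.

Lemma xcurve_b0 : b = 0 -> xc = id.
Proof. by move=> bE; apply/funext => c; rewrite /xcurve bE !mul0r expr0n /= !mul0r subr0 addr0 mulr1. Qed.

(** [c `^ k] is [1] for negative [c]; this even extension is continuous at
    [0], which is needed when [b = 0]. *)
Definition apow (c : R) := `|c| `^ k.

Lemma apowE (c : R) : 0 <= c -> apow c = c `^ k.
Proof. by move=> c0; rewrite /apow ger0_norm. Qed.

Lemma near_gt0 (c : R) : 0 < c -> \forall x \near c, (0 < x)%R.
Proof. by move=> c0; exact: lt_nbhsr. Qed.

Lemma is_derive_apow (c : R) : 0 < c -> is_derive (c : R) (1 : R) apow (k * apow c / c).
Proof.
move=> c0; rewrite apowE ?(ltW c0) //.
apply: (near_eq_is_derive (f := fun c : R => c `^ k)); last exact: is_derive_powk.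
near=> x; have x0 : 0 < x by near: x; exact: near_gt0.
by rewrite apowE // ltW.
Unshelve. all: by end_near. Qed.

Lemma cont_apow (c : R) : 0 <= c -> {for c, continuous apow}.
Proof.
rewrite le_eqVlt => /predU1P[<-|c0]; last exact: is_derive_continuous (is_derive_apow c0).
apply/cvgrPdist_le => e e0; rewrite /apow normr0 powR0 ?mulf_neq0 ?gt_eqF //.
near=> x; rewrite sub0r normrN ger0_norm ?powR_ge0 //.
(* Near [0], [|x| ^ (2 m) <= |x|] because [2 m >= 1]. *)
have xe : `|x| <= e.
  rewrite -[x]subr0 distrC; near: x; exact: cvgr_dist_le.
have x1 : `|x| <= 1.
  rewrite -[x]subr0 distrC; near: x; exact: cvgr_dist_le.
apply: le_trans xe; have [->|xn0] := eqVneq x 0.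
  by rewrite normr0 powR0 ?mulf_neq0 ?gt_eqF.
by apply: ge1r_powR => //; rewrite normr_gt0 xn0.
Unshelve. all: by end_near. Qed.

(** For [b = 0] the arc starts at [c = 0], where the formulas with [b / c] are
    not differentiable in form; there [b / c = 0] and they become polynomial. *)
Lemma bpos (c : R) : b <= c -> 0 < c \/ b = 0.
Proof.
move=> bc; have [bE|bn0] := eqVneq b 0; [by right|left].
by apply: lt_le_trans bc; rewrite lt_neqAle eq_sym bn0.
Qed.

Definition scurve (c : R) := xc c ^+ 2.
Definition dscurve (c : R) := 2 * xc c * dxcurve c.

Lemma is_derive_scurve (c : R) : 0 < c -> is_derive (c : R) (1 : R) scurve (dscurve c).
Proof.
move=> c0; have dx := is_derive_xcurve c0; rewrite /scurve /dscurve.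
by apply: is_derive_eq; rewrite /GRing.scale /=; ring.
Qed.

Lemma derivable_scurve (c : R) : b <= c -> derivable scurve c 1.
Proof.
move=> /bpos [c0|bE]; first by case: (is_derive_scurve c0).
by rewrite /scurve xcurve_b0.
Qed.

Lemma cont_scurve (c : R) : b <= c -> {for c, continuous scurve}.
Proof. by move=> bc; apply/differentiable_continuous/derivable1_diffP; exact: derivable_scurve. Qed.

Lemma cont_xcurve (c : R) : b <= c -> {for c, continuous xc}.
Proof.
move=> /bpos [c0|bE]; first exact: is_derive_continuous (is_derive_xcurve c0).
by rewrite xcurve_b0.
Qed.

Lemma cont_quot (c : R) : 0 < c -> {for c, continuous (fun c : R => b / c)}.
Proof. by move=> c0; exact: is_derive_continuous (is_derive_quot c0). Qed.

Lemma derivable_dxcurve (c : R) : 0 < c -> derivable dxcurve c 1.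
Proof.
move=> c0; have dp := is_derive_powk c0; have du := is_derive_quot c0.
rewrite /dxcurve.
have : exists d, is_derive (c : R) (1 : R) (fun c : R => 1 + (b / c) ^+ 2 - (b / c) ^+ 2 / m * (1 + (k - 1) * c `^ k)) d.
  by eexists.
by move=> [d []].
Qed.

Lemma cont_dscurve (c : R) : b <= c -> {for c, continuous (derive1 scurve)}.
Proof.
move=> /bpos [c0|bE]; last first.
  have dS (x : R) : is_derive (x : R) (1 : R) scurve (2 * x).
    rewrite /scurve xcurve_b0 //.
    have h : is_derive (x : R) (1 : R) (fun c : R => c ^+ 2) (2 * x).
      by apply: is_derive_eq; rewrite /GRing.scale /=; ring.
    exact: h.
  rewrite (is_derive_derive1 dS).
  have h : is_derive (c : R) (1 : R) (fun x : R => 2 * x) 2.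
    by apply: is_derive_eq; rewrite /GRing.scale /=; ring.
  exact: is_derive_continuous h.
have cd : {for c, continuous dscurve}.
  rewrite /dscurve; apply: cvgM; first apply: cvgM; first exact: cvg_cst.
    exact: is_derive_continuous (is_derive_xcurve c0).
  by apply/differentiable_continuous/derivable1_diffP; exact: derivable_dxcurve.
have E (x : R) : 0 < x -> derive1 scurve x = dscurve x.
  by move=> x0; rewrite derive1E; case: (is_derive_scurve x0).
suff : derive1 scurve x @[x --> c] --> derive1 scurve c by [].
rewrite E //; apply: cvg_trans cd.
apply: near_eq_cvg; near=> x.
have x0 : 0 < x by near: x; exact: near_gt0.
by rewrite E.
Unshelve. all: by end_near. Qed.

Lemma dxcurve_gt0 (c : R) : b < c -> c <= 1 -> 0 < dxcurve c.
Proof.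
move=> bc c1; have c0 : 0 < c by exact: le_lt_trans bc.
have p1 : c `^ k <= 1 by apply: powR_le1; rewrite ?(ltW c0) // ?(le_trans _ k1).
rewrite /dxcurve; set u := (b / c) ^+ 2.
have u1 : u < 1.
  by rewrite /u exprn_ilt1 // ?divr_ge0 // ?(ltW c0) // ltr_pdivrMr // mul1r.
have u0 : 0 <= u by exact: sqr_ge0.
have h : u / m * (1 + (k - 1) * c `^ k) <= u / m * k.
  apply: ler_wpM2l; first by rewrite divr_ge0 // ltW.
  have kp : (k - 1) * c `^ k <= k - 1 by rewrite ler_piMr // subr_ge0.
  lra.
have E : u / m * k = 2 * u by field; rewrite gt_eqF.
rewrite E in h; lra.
Qed.

Lemma xcurve_lt : {in `[b, 1] &, {homo xc : x y / x < y}}.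
Proof.
apply: (@gtr0_derive1_lt_cc R xc b 1).
- move=> x; rewrite in_itv /= => /andP[bx _].
  by have [] := is_derive_xcurve (le_lt_trans b0 bx).
- move=> x; rewrite in_itv /= => /andP[bx x1].
  have [_] := is_derive_xcurve (le_lt_trans b0 bx); rewrite derive1E => ->.
  by rewrite dxcurve_gt0 // ltW.
- apply: continuous_in_subspaceT => x; rewrite inE /= in_itv /= => /andP[bx _].
  exact: cont_xcurve.
Qed.

Lemma xcurve_ge0 (c : R) : b <= c <= 1 -> 0 <= xc c.
Proof.
move=> /andP[bc c1]; have c0 := le_trans b0 bc.
have p1 : c `^ k <= 1 by apply: powR_le1; rewrite ?c0 // (le_trans _ k1).
rewrite /xcurve mulr_ge0 // addr_ge0 //.
  rewrite subr_ge0 exprn_ile1 ?divr_ge0 //.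
  have [/eqP|cn0] := eqVneq c 0; first by move=> /eqP ->; rewrite invr0 mulr0.
  by rewrite ler_pdivrMr ?mul1r // lt_neqAle eq_sym cn0.
apply: divr_ge0; last exact: ltW.
by apply: mulr_ge0; [exact: sqr_ge0|rewrite subr_ge0].
Qed.

Lemma scurve_lt : {in `[b, 1] &, {homo scurve : x y / x < y}}.
Proof.
move=> x y xI yI xy.
have x0 : 0 <= xc x by apply: xcurve_ge0; move: xI; rewrite in_itv.
have y0 : 0 <= xc y by apply: xcurve_ge0; move: yI; rewrite in_itv.
by rewrite /scurve ltr_pXn2r ?nnegrE //; exact: xcurve_lt.
Qed.

Definition sinv (s : R) : R := get [set c | b <= c <= 1 /\ scurve c = s].

Lemma scurveK : {in `[b, 1], cancel scurve sinv}.
Proof.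
move=> c; rewrite in_itv /= => cI.
have [] := @getPex _ [set c' | b <= c' <= 1 /\ scurve c' = scurve c] (ex_intro _ c (conj cI erefl)).
rewrite -/(sinv _) => dI dE; apply/eqP; rewrite eq_le !leNgt.
by apply/andP; split; apply/negP => h; have := scurve_lt _ _ h; rewrite !in_itv /= dE cI dI ltxx => /(_ isT isT).
Qed.

Lemma sinvK (s : R) : scurve b <= s <= scurve 1 -> b <= sinv s <= 1 /\ scurve (sinv s) = s.
Proof.
move=> sI.
have cS : {within `[b, 1], continuous scurve}.
  by apply: continuous_in_subspaceT => x; rewrite inE /= in_itv /= => /andP[bx _]; exact: cont_scurve.
have [c cI cE] : exists2 c, c \in `[b, 1]%R & scurve c = s.
  apply: IVT => //; first exact: ltW.
  have sb : scurve b <= scurve 1 by case/andP: sI => /le_trans; apply.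
  by rewrite (min_idPl sb) (max_idPr sb).
rewrite -cE scurveK //; split => //; by move: cI; rewrite in_itv.
Qed.

Lemma cont_sinv : {within `[scurve b, scurve 1], continuous sinv}.
Proof.
apply: segment_can_le_continuous; [exact: ltW| |exact: scurveK].
by apply: continuous_in_subspaceT => x; rewrite inE /= in_itv /= => /andP[bx _]; exact: cont_scurve.
Qed.

(** [ycurve] with [apow] for the power. *)
Definition yext (c : R) := (1 - apow c) * (1 - apow c * (b / c) ^+ 2).

Lemma yextE (c : R) : 0 <= c -> yext c = yc c.
Proof. by move=> c0; rewrite /yext /ycurve apowE. Qed.

Lemma cont_yext (c : R) : b <= c -> {for c, continuous yext}.
Proof.
move=> bc; have c0 := le_trans b0 bc; have ca := cont_apow c0.
have c1a : {for c, continuous (fun c => 1 - apow c)} by apply: cvgB => //; exact: cvg_cst.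
case: (bpos bc) => [cp|bE].
  rewrite /yext; apply: cvgM => //; apply: cvgB; first exact: cvg_cst.
  by apply: cvgM => //; apply: cvgM; exact: cont_quot.
have -> : yext = fun c => 1 - apow c.
  by apply/funext => x; rewrite /yext bE !mul0r expr0n /= mulr0 subr0 mulr1.
exact: c1a.
Qed.

(** Substitution [s = scurve c], then the fundamental theorem of calculus for
    a primitive [K] of [ycurve * scurve']. *)
Lemma profile_integral (K : R -> R) :
  (forall c, b <= c <= 1 -> {for c, continuous K}) ->
  (forall c, b < c < 1 -> is_derive (c : R) (1 : R) K (yc c * dscurve c)) ->
  (\int[mu]_(s in `[scurve b, scurve 1]) (yext (sinv s))%:E = (K 1 - K b)%:E)%E.
Proof.
move=> cK dK.
have LR (f : R -> R) : (forall c, b <= c <= 1 -> {for c, continuous f}) ->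
    (forall c, b < c < 1 -> derivable f c 1) -> derivable_oo_LRcontinuous f b 1.
  move=> cf df; split; first by move=> x; rewrite in_itv; exact: df.
    by apply: cvg_at_right_filter; apply: cf; rewrite lexx ltW.
  by apply: cvg_at_left_filter; apply: cf; rewrite lexx ltW.
have dS : derivable_oo_LRcontinuous scurve b 1.
  apply: LR => c; first by move=> /andP[bc _]; exact: cont_scurve.
  by move=> /andP[bc _]; apply: derivable_scurve; exact: ltW.
rewrite (@integration_by_substitution_increasing _ scurve (yext \o sinv) b 1) //.
- transitivity (\int[mu]_(c in `[b, 1%R]) (yext c * derive1 scurve c)%:E)%E.
    apply: eq_integral => c; rewrite inE /= => cI; congr (_%:E).
    by rewrite fctE /= scurveK.
  rewrite (@continuous_FTC2 _ _ K) //.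
  + apply: continuous_in_subspaceT => c; rewrite inE /= in_itv /= => /andP[bc _].
    by apply: cvgM; [exact: cont_yext|exact: cont_dscurve].
  + by apply: LR => // c /dK [].
  + move=> c; rewrite in_itv /= => cI; rewrite derive1E; case: (dK c cI) => _ ->.
    have [bc _] := andP cI; have c0 := le_lt_trans b0 bc.
    rewrite yextE ?(ltW c0) // derive1E; congr (_ * _).
    by case: (is_derive_scurve c0).
- exact: ltW.
- exact: scurve_lt.
- by move=> c; rewrite in_itv /= => /andP[bc _]; apply: cont_dscurve; exact: ltW.
- apply: cvgP; apply: cvg_at_right_filter; exact: cont_dscurve.
- apply: cvgP; apply: cvg_at_left_filter; apply: cont_dscurve; exact: ltW.
- apply: within_continuous_comp; last exact: cont_sinv.
  move=> c; rewrite inE /= => -[s sI <-]; apply: cont_yext.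
  by have [] := @sinvK s; [move: sI; rewrite /= in_itv|case/andP].
Qed.

End profile_curve.

(** * The indicatrix as a Reinhardt set *)

Section volume.
Variables (R : realType) (m b : R).
Hypothesis m12 : 1 / 2 <= m.
Hypothesis b01 : 0 <= b < 1.
Let m0 : 0 < m. Proof. exact: half_le_gt0. Qed.
Let k1 : 1 <= 2 * m. Proof. exact: half_le_mul2. Qed.
Let b0 : 0 <= b. Proof. by case/andP: b01. Qed.
Let b1 : b < 1. Proof. by case/andP: b01. Qed.
Local Notation k := (2 * m).
Local Notation xc := (xcurve m b).
Local Notation yc := (ycurve m b).
Local Notation sc := (scurve m b).
Local Notation si := (sinv m b).
Local Notation ye := (yext m b).
Notation mu := (@lebesgue_measure R).
Notation TR := (measurableTypeR R).
Local Notation I := (kobayashi_indicatrix (ellipsoid m) ((b%:C%C, 0) : C2 R)).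
Local Notation beta := (b `^ k).

Let x0 : R := b / m * (1 - beta).

Lemma beta01 : 0 <= beta < 1.
Proof. by rewrite powR_ge0 powR_lt1 // mulr_gt0. Qed.

Lemma xcurveb : xc b = x0.
Proof.
rewrite /xcurve /x0; have [bE|bn0] := eqVneq b 0; first by rewrite bE !mul0r.
by field; rewrite bn0 gt_eqF.
Qed.

Lemma x0_gt0 : b != 0 -> 0 < x0.
Proof.
have /andP[_ h] := beta01 => bn0.
by rewrite /x0 mulr_gt0 ?divr_gt0 ?subr_gt0 // lt_neqAle eq_sym bn0.
Qed.

Lemma xcurve1 : xc 1 = 1 - b ^+ 2.
Proof. by rewrite /xcurve powR1 subrr mulr0 mul0r addr0 divr1 mul1r. Qed.

Lemma scurveb_le1 : sc b <= sc 1.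
Proof.
by apply/ltW/scurve_lt => //; rewrite in_itv /= ?lexx ltW.
Qed.

(** On the first arc [p ^ 2 = s / xcurve b ^ 2]; the second arc starts at
    [c = b], where the first one ends. *)
Definition profile (s : R) :=
  if s <= sc b then (1 - beta) * (1 - beta * (s / sc b)) else ye (si s).

Lemma beta0 : b = 0 -> beta = 0.
Proof. by move=> ->; rewrite powR0 // mulf_neq0 // gt_eqF. Qed.

(** At the junction of the arcs and at [c = 1] the support inequalities
    degenerate; there the bound is the limit of those at nearby points, which
    apply because they bound [|X2|] whenever [|X1|] is at least the abscissa of
    the contact point. *)
Lemma indicatrix_sub_region (X1 X2 : R[i]) : I (X1, X2) ->
  normc X1 ^+ 2 <= sc 1 /\ normc X2 ^+ 2 <= profile (normc X1 ^+ 2).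
Proof.
move=> /indicatrix_abs; move: (normc_ge0 X1) (normc_ge0 X2).
move: (normc X1) (normc X2) => x y xge0 yge0 hI.
have x1 : x <= xc 1 by rewrite xcurve1; exact: (indicatrix_width m12 b01 hI).
have xs1 : x ^+ 2 <= sc 1.
  by rewrite ler_pXn2r ?nnegrE // (le_trans xge0).
split => //; rewrite /profile; case: ifPn => hx.
  have [bE|bn0] := eqVneq b 0.
    have := @indicatrix_below_arc0 R m b m12 0 x y b01.
    rewrite lexx ltr01 => /(_ isT yge0 hI).
    rewrite mulr0 mul0r => /(_ xge0); rewrite beta0 //.
    by rewrite !mul0r.
  have xp := x0_gt0 bn0.
  have /andP[be0 be1] := beta01.
  rewrite /scurve xcurveb in hx.
  have xx0 : x <= x0 by rewrite -(@ler_pXn2r _ 2) ?nnegrE // ltW.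
  rewrite /scurve xcurveb.
  pose p := x / x0.
  have p0 : 0 <= p by rewrite divr_ge0 // ltW.
  have p1 : p <= 1 by rewrite ler_pdivrMr // mul1r.
  rewrite -expr_div_n -/p.
  suff : (1 - beta) * beta * p ^+ 2 <= (1 - beta) - y ^+ 2 by move=> ?; lra.
  apply: le_of_scaled_le => t /andP[t0 t1].
  have r0 : 0 <= Num.sqrt t by exact: sqrtr_ge0.
  have r1 : Num.sqrt t < 1 by rewrite -sqrtr1 ltr_sqrt.
  have := @indicatrix_below_arc0 R m b m12 (Num.sqrt t * p) x y b01.
  have rp0 : 0 <= Num.sqrt t * p by exact: mulr_ge0.
  have rp1 : Num.sqrt t * p < 1 by apply: le_lt_trans r1; rewrite ler_piMr.
  rewrite rp0 rp1 => /(_ isT yge0 hI).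
  have -> : b / m * (Num.sqrt t * p) * (1 - beta) = Num.sqrt t * x.
    rewrite /p /x0; field; rewrite bn0 gt_eqF //= subr_eq0 eq_sym lt_eqF //.
  have -> : Num.sqrt t * x <= x by rewrite ler_piMl // ltW.
  rewrite exprMn sqr_sqrtr ?(ltW t0) // => /(_ isT) ?; lra.
have sI : sc b <= x ^+ 2 <= sc 1 by rewrite xs1 andbT ltW // ltNge.
have [/andP[bc c1] cE] := sinvK m12 b01 sI.
set c := si (x ^+ 2) in bc c1 cE *.
have cb : b < c.
  rewrite lt_neqAle bc andbT; apply/eqP => E.
  by move: hx; rewrite -cE -E lexx.
have c0 : 0 < c by exact: le_lt_trans cb.
rewrite (yextE m b (ltW c0)).
have xcE : xc c = x.
  have xc0 : 0 <= xc c by apply: xcurve_ge0 => //; rewrite bc c1.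
  by move/eqP: cE; rewrite /scurve eqrXn2 // => /eqP.
have [cE1|cn1] := eqVneq c 1; last first.
  have clt : c < 1 by rewrite lt_neqAle cn1.
  by apply: (@indicatrix_below_arc1 R m b m12 c x y b0 c0) => //; rewrite ?cb ?xcE.
rewrite cE1 in xcE *.
have -> : yc 1 = 0 by rewrite /ycurve powR1 subrr mul0r.
suff : k * (1 - b) <= k * (1 - b) - y ^+ 2 by move=> ?; lra.
apply: le_of_scaled_le => r /andP[r0 r1].
(* At [c = 1] the bound follows from [ycurve d <= 1 - d ^ (2 m)] as [d] tends
   to [1]. *)
pose d := 1 - (1 - r) * (1 - b).
have db : b < d.
  have -> : d = b + r * (1 - b) by rewrite /d; ring.
  by rewrite ltrDl mulr_gt0 // subr_gt0.
have d1 : d < 1 by rewrite /d gtrBl mulr_gt0 // subr_gt0.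
have d0 : 0 < d by exact: le_lt_trans db.
have yd : y ^+ 2 <= yc d.
  apply: (@indicatrix_below_arc1 R m b m12 d x y b0 d0) => //; first by rewrite db d1.
  by rewrite -xcE; apply/ltW/(xcurve_lt m12 b01) => //; rewrite in_itv /= ?lexx ?(ltW db) ?(ltW d1) ?(ltW b1).
have dk1 : d `^ k <= 1 by apply: powR_le1; rewrite ?(ltW d0) ?(ltW d1) // (le_trans _ k1).
have dk0 : 0 <= d `^ k by exact: powR_ge0.
have ydd : yc d <= 1 - d `^ k.
  by rewrite /ycurve ler_piMr ?subr_ge0 // gerBl mulr_ge0 // sqr_ge0.
have bern := bernoulli_powR m12 (ltW d0).
have E : k * (d - 1) = r * (k * (1 - b)) - k * (1 - b) by rewrite /d; ring.
rewrite E in bern; lra.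
Qed.

Lemma region_sub_indicatrix (X1 X2 : R[i]) :
  normc X1 ^+ 2 <= sc 1 -> normc X2 ^+ 2 <= profile (normc X1 ^+ 2) -> I (X1, X2).
Proof.
have xge0 := normc_ge0 X1; set x := normc X1 in xge0 *.
move=> xs1; rewrite /profile; case: ifPn => hx hy.
  have [bE|bn0] := eqVneq b 0.
    have x00 : x0 = 0 by rewrite /x0 bE !mul0r.
    have xz : x = 0.
      move: hx; rewrite /scurve xcurveb x00 expr0n /= => h.
      by apply/eqP; rewrite -sqrf_eq0 eq_le h sqr_ge0.
    apply: (@arc0_in_indicatrix R m b m12 0) => //; first by rewrite lexx ler01.
      by rewrite -/x xz mulr0 mul0r.
    by move: hy; rewrite beta0 // !mul0r.
  have xp := x0_gt0 bn0; have /andP[be0 be1] := beta01.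
  rewrite /scurve xcurveb in hx hy.
  have xx0 : x <= x0 by rewrite -(@ler_pXn2r _ 2) ?nnegrE // ltW.
  apply: (@arc0_in_indicatrix R m b m12 (x / x0)) => //.
  - by rewrite divr_ge0 ?(ltW xp) //= ler_pdivrMr // mul1r.
  - rewrite -/x /x0; field; rewrite bn0 gt_eqF //= subr_eq0 eq_sym lt_eqF //.
  - by rewrite expr_div_n.
have sI : sc b <= x ^+ 2 <= sc 1 by rewrite xs1 andbT ltW // ltNge.
have [/andP[bc c1] cE] := sinvK m12 b01 sI.
set c := si (x ^+ 2) in bc c1 cE hy.
have cb : b < c.
  rewrite lt_neqAle bc andbT; apply/eqP => E.
  by move: hx; rewrite -cE -E lexx.
have c0 : 0 < c by exact: le_lt_trans cb.
rewrite (yextE m b (ltW c0)) in hy.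
have xcE : xc c = x.
  have xc0 : 0 <= xc c by apply: xcurve_ge0 => //; rewrite bc c1.
  by move/eqP: cE; rewrite /scurve eqrXn2 // => /eqP.
by apply: (@arc1_in_indicatrix R m b m12 c) => //; rewrite ?bc // -/x -xcE.
Qed.

Lemma scurveb_ge0 : 0 <= sc b.
Proof. exact: sqr_ge0. Qed.

Lemma profile_ge0 (s : R) : 0 <= s <= sc 1 -> 0 <= profile s.
Proof.
move=> /andP[s0 s1]; rewrite /profile; case: ifPn => hs.
  have /andP[be0 be1] := beta01; rewrite mulr_ge0 ?subr_ge0 ?(ltW be1) //.
  apply: le_trans (ltW be1); rewrite ler_piMr //.
  have [->|sn0] := eqVneq (sc b) 0; first by rewrite invr0 mulr0.
  by rewrite ler_pdivrMr ?mul1r // lt_neqAle eq_sym sn0 scurveb_ge0.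
have sI : sc b <= s <= sc 1 by rewrite s1 andbT ltW // ltNge.
have [/andP[bc c1] _] := sinvK m12 b01 sI.
have c0 := le_trans b0 bc.
rewrite yextE //; apply: sqrt_factor_ge0; first by rewrite powR_ge0 powR_le1 ?c0 // (le_trans _ k1).
rewrite divr_ge0 //=; have [->|cn0] := eqVneq (si s) 0; first by rewrite invr0 mulr0.
by rewrite ler_pdivrMr ?mul1r // lt_neqAle eq_sym cn0.
Qed.

Lemma cont_yext_sinv : {within `[sc b, sc 1], continuous (ye \o si)}.
Proof.
apply: within_continuous_comp; last exact: cont_sinv.
move=> c; rewrite inE /= => -[s sI <-]; apply: cont_yext => //.
by have [] := @sinvK _ _ _ m12 b01 s; [move: sI; rewrite /= in_itv|case/andP].
Qed.

Lemma measurable_yext_sinv :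
  measurable_fun (`]sc b, sc 1]%classic : set TR) (ye \o si : TR -> R).
Proof.
apply: (@measurable_funS _ _ _ _ (`[sc b, sc 1]%classic : set TR)).
- exact: measurable_itv.
- by apply: subset_itvr; rewrite bnd_simp.
- apply: subspace_continuous_measurable_fun; first exact: measurable_itv.
  exact: cont_yext_sinv.
Qed.

Lemma cont_profile0 : {within `[0%R, sc b],
  continuous (fun s : R => (1 - beta) + (- ((1 - beta) * beta / sc b)) * (s - 0))}.
Proof.
apply: continuous_subspaceT => x.
have h : is_derive (x : R) (1 : R) (fun s : R => (1 - beta) + (- ((1 - beta) * beta / sc b)) * (s - 0))
  (- ((1 - beta) * beta / sc b)).
  by apply: is_derive_eq; rewrite /GRing.scale /=; ring.
exact: is_derive_continuous h.
Qed.

Lemma profile_split :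
  `[0%R, sc 1]%classic = `[0%R, sc b]%classic `|` `]sc b, sc 1]%classic :> set R.
Proof.
apply/seteqP; split => s /=; rewrite !in_itv /=.
  move=> /andP[s0 s1]; have [h|h] := leP s (sc b); [left|right].
    by rewrite s0.
  by rewrite s1.
move=> [/andP[-> /= h]|/andP[h ->]].
  exact: le_trans h scurveb_le1.
by rewrite andbT (le_trans scurveb_ge0) // ltW.
Qed.

Lemma measurable_profile : measurable_fun (`[0%R, sc 1]%classic : set TR) (profile : TR -> R).
Proof.
have mA : measurable (`[0%R, sc b]%classic : set TR) by exact: measurable_itv.
have mB : measurable (`]sc b, sc 1]%classic : set TR) by exact: measurable_itv.
rewrite profile_split; apply/(measurable_funU _ mA mB); split.
  apply: (eq_measurable_fun (fun s : R => (1 - beta) + (- ((1 - beta) * beta / sc b)) * (s - 0))).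
    move=> s; rewrite inE /= in_itv /= => /andP[_ h]; rewrite /profile h; ring.
  apply: subspace_continuous_measurable_fun => //; exact: cont_profile0.
apply: (eq_measurable_fun (ye \o si)).
  by move=> s; rewrite inE /= in_itv /= => /andP[h _]; rewrite /profile leNgt h.
exact: measurable_yext_sinv.
Qed.

(** The first arc contributes the integral of an affine function of [s], the
    second one the increment of a primitive. *)
Lemma indicatrix_volume (K : R -> R) :
  (forall c, b <= c <= 1 -> {for c, continuous K}) ->
  (forall c, b < c < 1 -> is_derive (c : R) (1 : R) K (yc c * dscurve m b c)) ->
  lebesgue_measure_C2 I =
  (pi ^+ 2 * ((1 - beta) * (sc b - beta * sc b / 2) + (K 1 - K b)))%:E.
Proof.
move=> cK dK.
rewrite (@reinhardt_volume _ _ (sc 1) profile); first last.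
- move=> X1 X2; split; first exact: indicatrix_sub_region.
  by move=> [h1 h2]; exact: region_sub_indicatrix.
- exact: profile_ge0.
- exact: measurable_profile.
rewrite [RHS]EFinM; congr (_ * _)%E.
rewrite profile_split ge0_integral_setU //=; first last.
- apply/disj_setPLR => s /=; rewrite !in_itv /= => /andP[_ h] /andP[h2 _].
  by move: h2; rewrite ltNge h.
- move=> s hs; have {}hs : `[0%R, sc 1]%classic s by rewrite profile_split.
  by move: hs; rewrite /= in_itv /= => h; rewrite lee_fin profile_ge0.
- by rewrite -profile_split; apply/measurable_EFinP; exact: measurable_profile.
rewrite EFinD; congr (_ + _)%E.
  transitivity (\int[mu]_(s in `[0%R, sc b]) ((1 - beta) + (- ((1 - beta) * beta / sc b)) * (s - 0))%:E)%E.
    apply: eq_integral => s; rewrite inE /= in_itv /= => /andP[_ h].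
    by rewrite /profile h; congr (_%:E); ring.
  rewrite integral_affine ?scurveb_ge0 //; congr (_%:E).
  have [->|sn0] := eqVneq (sc b) 0; first by rewrite invr0; ring.
  by field.
rewrite -(profile_integral m12 b01 cK dK).
rewrite -integral_itv_obnd_cbnd; last by apply/measurable_EFinP; exact: measurable_yext_sinv.
apply: eq_integral => s; rewrite inE /= in_itv /= => /andP[h _].
by rewrite /profile leNgt h.
Qed.

End volume.

(** * A primitive along the second arc *)

Section primitive.
Variables (R : realType) (m b : R).
Hypothesis m12 : 1 / 2 <= m.
Hypothesis b01 : 0 <= b < 1.
Let m0 : 0 < m. Proof. exact: half_le_gt0. Qed.
Let k1 : 1 <= 2 * m. Proof. exact: half_le_mul2. Qed.
Let b0 : 0 <= b. Proof. by case/andP: b01. Qed.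
Let b1 : b < 1. Proof. by case/andP: b01. Qed.
Local Notation k := (2 * m).
Local Notation P := (m^-1 - 1).
Local Notation T := (b ^+ 2).
Local Notation beta := (b `^ k).

(** Term by term primitive of [ycurve * scurve'], expanded in the monomials
    [c ^ i C ^ j] with [C = c ^ (2 m)] (grouped by powers of [q = b / c]), apart
    from the two monomials of [resonant_part]. The coefficients are simplified
    so that no denominator vanishes for [m >= 1/2]. *)
Definition regular_primitive (c : R) :=
  let C := apow m c in let q := b / c in
  c ^+ 2 - (m + 1)^-1 * (c ^+ 2 * C) - 3 * T / m * C + 3 * T / (2 * m) * C ^+ 2
  + T * P ^+ 2 * q ^+ 2 - 3 * P * T / m * (q ^+ 2 * C) + 3 * T / m ^+ 2 * (q ^+ 2 * C ^+ 2)
  - (2 * m ^+ 2 + 2 * m - 1) * T / (m ^+ 2 * (3 * m - 1)) * (q ^+ 2 * C ^+ 3)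
  + 3 * P * T / (2 * m) * (q ^+ 4 * C ^+ 2) + T / (2 * m ^+ 2) * (q ^+ 4 * C ^+ 4).

(** The monomials [q ^ 4 C / c] and [q ^ 4 C ^ 3 / c] have the exponents
    [2 m - 5] and [6 m - 5] in [c]; they have a logarithmic primitive for [m = 2]
    and [m = 2/3] respectively. *)
Definition resonant_part (c : R) :=
  let C := apow m c in let q := b / c in
  2 * P ^+ 2 * T * (q ^+ 4 * C / c) +
  (4 * m ^+ 2 - 12 * m + 6) / m ^+ 2 * T * (q ^+ 4 * C ^+ 3 / c).

Lemma is_derive_regular_primitive (c : R) : 0 < c ->
  is_derive (c : R) (1 : R) regular_primitive
    (ycurve m b c * dscurve m b c - resonant_part c).
Proof.
move=> c0; have dC := is_derive_apow m12 c0; have dq := is_derive_quot b c0.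
have m1 : m + 1 != 0 by rewrite gt_eqF // addr_gt0.
have m3 : 3 * m - 1 != 0.
  by rewrite gt_eqF // subr_gt0; have h := k1; have h2 := m0; lra.
rewrite /regular_primitive; apply: is_derive_eq.
rewrite /GRing.scale /= /resonant_part /ycurve /dscurve /xcurve /dxcurve -apowE ?(ltW c0) //.
by field; rewrite m1 m3 !gt_eqF.
Qed.

Lemma powm_cube : b `^ (6 * m + 2) = beta ^+ 3 * b ^+ 2.
Proof.
have [->|bn0] := eqVneq b 0.
  rewrite expr0n mulr0 powR0 // gt_eqF // addr_gt0 // mulr_gt0 //.
rewrite powRD ?bn0 ?implybT // powR_mulrn //; congr (_ * _).
rewrite -[in RHS]powR_mulrn ?powR_ge0 // -powRrM; congr (_ `^ _); ring.
Qed.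

Lemma powm_one : b `^ (2 * m + 2) = beta * b ^+ 2.
Proof.
have [->|bn0] := eqVneq b 0.
  rewrite expr0n mulr0 powR0 // gt_eqF // addr_gt0 // mulr_gt0 //.
by rewrite powRD ?bn0 ?implybT // powR_mulrn.
Qed.

Lemma indicatrix_volume_primitive (e : R -> R) :
  (b = 0 -> forall c, e c = 0) ->
  (forall c, 0 < c -> is_derive (c : R) (1 : R) e (resonant_part c)) ->
  lebesgue_measure_C2 (kobayashi_indicatrix (ellipsoid m) ((b%:C%C, 0) : C2 R)) =
  (pi ^+ 2 *
   ((1 - beta) * ((b / m * (1 - beta)) ^+ 2 * (1 - beta / 2)) +
    (1 - (m + 1)^-1 - 3 * T / m + 3 * T / (2 * m) + T * P ^+ 2 * T - 3 * P * T / m * T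
     + 3 * T / m ^+ 2 * T - (2 * m ^+ 2 + 2 * m - 1) * T / (m ^+ 2 * (3 * m - 1)) * T
     + 3 * P * T / (2 * m) * T ^+ 2 + T / (2 * m ^+ 2) * T ^+ 2) -
    (T - (m + 1)^-1 * (T * beta) - 3 * T / m * beta + 3 * T / (2 * m) * beta ^+ 2
     + T * P ^+ 2 - 3 * P * T / m * beta + 3 * T / m ^+ 2 * beta ^+ 2
     - (2 * m ^+ 2 + 2 * m - 1) * T / (m ^+ 2 * (3 * m - 1)) * beta ^+ 3
     + 3 * P * T / (2 * m) * beta ^+ 2 + T / (2 * m ^+ 2) * beta ^+ 4) +
    (e 1 - e b)))%:E.
Proof.
move=> e0 de; pose K c := regular_primitive c + e c.
have dK (c : R) : 0 < c -> is_derive (c : R) (1 : R) K (ycurve m b c * dscurve m b c).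
  move=> c0; have h1 := is_derive_regular_primitive c0; have h2 := de c c0.
  by apply: is_derive_eq; rewrite subrK.
have cK c : b <= c <= 1 -> {for c, continuous K}.
  move=> /andP[bc c1]; have [c0|bE] := bpos b01 bc.
    exact: is_derive_continuous (dK c c0).
  have -> : K = fun c => c ^+ 2 - (m + 1)^-1 * (c ^+ 2 * apow m c).
    apply/funext => x; rewrite /K e0 // /regular_primitive bE expr0n /=; ring.
  have h : {for c, continuous (fun c : R => c ^+ 2)}.
    have h : is_derive (c : R) (1 : R) (fun c : R => c ^+ 2) (2 * c).
      by apply: is_derive_eq; rewrite /GRing.scale /=; ring.
    exact: is_derive_continuous h.
  apply: cvgB; first exact: h.
  apply: cvgM; first exact: cvg_cst.
  by apply: cvgM; [exact: h|apply: cont_apow => //; exact: le_trans b0 bc].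
have dK' c : b < c < 1 -> is_derive (c : R) (1 : R) K (ycurve m b c * dscurve m b c).
  by move=> /andP[bc _]; apply: dK; exact: le_lt_trans b0 bc.
rewrite (indicatrix_volume m12 b01 cK dK').
congr ((_ * _)%:E).
have -> : scurve m b b = (b / m * (1 - beta)) ^+ 2 by rewrite /scurve xcurveb.
have r1 : regular_primitive 1 =
  1 - (m + 1)^-1 - 3 * T / m + 3 * T / (2 * m) + T * P ^+ 2 * T - 3 * P * T / m * T
   + 3 * T / m ^+ 2 * T - (2 * m ^+ 2 + 2 * m - 1) * T / (m ^+ 2 * (3 * m - 1)) * T
   + 3 * P * T / (2 * m) * T ^+ 2 + T / (2 * m ^+ 2) * T ^+ 2.
  by rewrite /regular_primitive /apow normr1 powR1 divr1; ring.
have rb : regular_primitive b =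
  T - (m + 1)^-1 * (T * beta) - 3 * T / m * beta + 3 * T / (2 * m) * beta ^+ 2
   + T * P ^+ 2 - 3 * P * T / m * beta + 3 * T / m ^+ 2 * beta ^+ 2
   - (2 * m ^+ 2 + 2 * m - 1) * T / (m ^+ 2 * (3 * m - 1)) * beta ^+ 3
   + 3 * P * T / (2 * m) * beta ^+ 2 + T / (2 * m ^+ 2) * beta ^+ 4.
  rewrite /regular_primitive apowE //.
  have [->|bn0] := eqVneq b 0; first by rewrite expr0n /=; ring.
  by rewrite divff //; ring.
by rewrite /K r1 rb; ring.
Qed.
End primitive.

(** * The three closed formulas *)

Section formulas.
Variable R : realType.

Lemma volume_generic (m b : R) : 1 / 2 <= m -> m <> 2 / 3 -> m <> 2 -> 0 <= b -> b < 1 ->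
  lebesgue_measure_C2 (kobayashi_indicatrix (ellipsoid m) ((b%:C%C, 0) : C2 R)) =
  (pi ^+ 2 *
         (- ((m - 1) / (2 * m * (3 * m - 2) * (3 * m - 1)) * b `^ (6 * m + 2))
          - 3 * (m - 1) / (2 * m * (m - 2) * (m + 1)) * b `^ (2 * m + 2)
          + m / (2 * (m - 2) * (3 * m - 2)) * b ^+ 6
          + 3 * m / (3 * m - 1) * b ^+ 4
          - (4 * m - 1) / (2 * m) * b ^+ 2
          + m / (m + 1)))%:E.
Proof.
move=> m12 m23 m2 b0 b1; have b01 : 0 <= b < 1 by rewrite b0.
have m0 : 0 < m by lra.
have mn0 : m != 0 by rewrite gt_eqF.
have n1 : m + 1 != 0 by rewrite gt_eqF //; lra.
have n2 : 3 * m - 1 != 0 by rewrite gt_eqF //; lra.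
have n3 : m - 2 != 0 by apply/eqP => h; apply: m2; lra.
have n4 : 3 * m - 2 != 0 by apply/eqP => h; apply: m23; lra.
pose P := m^-1 - 1.
pose e c := P ^+ 2 * b ^+ 2 / (m - 2) * ((b / c) ^+ 4 * apow m c) +
  (2 * m ^+ 2 - 6 * m + 3) / (m ^+ 2 * (3 * m - 2)) * b ^+ 2 * ((b / c) ^+ 4 * apow m c ^+ 3).
have e0 : b = 0 -> forall c, e c = 0.
  by move=> bE c; rewrite /e bE expr0n /=; ring.
have de (c : R) : 0 < c -> is_derive (c : R) (1 : R) e (resonant_part m b c).
  move=> c0; have dC := is_derive_apow m12 c0; have dq := is_derive_quot b c0.
  rewrite /e /resonant_part; apply: is_derive_eq; rewrite /GRing.scale /= /P.
  by field; rewrite mn0 n3 n4 !gt_eqF.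
rewrite (indicatrix_volume_primitive m12 b01 e0 de).
congr ((_ * _)%:E).
rewrite powm_cube // powm_one //.
have -> : e 1 = P ^+ 2 * b ^+ 2 / (m - 2) * b ^+ 4 +
   (2 * m ^+ 2 - 6 * m + 3) / (m ^+ 2 * (3 * m - 2)) * b ^+ 2 * b ^+ 4.
  by rewrite /e /apow normr1 powR1 divr1 expr1n !mulr1.
have -> : e b = P ^+ 2 * b ^+ 2 / (m - 2) * b `^ (2 * m) +
   (2 * m ^+ 2 - 6 * m + 3) / (m ^+ 2 * (3 * m - 2)) * b ^+ 2 * (b `^ (2 * m)) ^+ 3.
  rewrite /e apowE //; have [->|bn0] := eqVneq b 0; first by rewrite expr0n /=; ring.
  by rewrite divff // expr1n !mul1r.
rewrite /P; set be := b `^ (2 * m); clearbody be.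
by field; rewrite mn0 n1 n2 n3 n4.
Qed.

Lemma volume_two_thirds (b : R) : 0 <= b -> b < 1 ->
  lebesgue_measure_C2 (kobayashi_indicatrix (ellipsoid (2 / 3)) ((b%:C%C, 0) : C2 R)) =
  (pi ^+ 2 / 80 *
         (- (65 * b ^+ 6) + 40 * (b ^+ 6 * ln b) + 160 * b ^+ 4
          - 27 * b `^ (10 / 3) - 100 * b ^+ 2 + 32))%:E.
Proof.
move=> b0 b1; have b01 : 0 <= b < 1 by rewrite b0.
have m12 : 1 / 2 <= 2 / 3 :> R by lra.
pose m : R := 2 / 3.
have C3 (c : R) : 0 <= c -> (c `^ (2 * m)) ^+ 3 = c ^+ 4.
  move=> c0; rewrite -powR_mulrn ?powR_ge0 // -powRrM -powR_mulrn //.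
  by congr (_ `^ _); rewrite /m; field.
pose e c := - (3 / 16) * b ^+ 2 * ((b / c) ^+ 4 * apow m c) - b ^+ 6 / 2 * ln c.
have e0 : b = 0 -> forall c, e c = 0.
  by move=> bE c; rewrite /e bE expr0n /=; ring.
have de (c : R) : 0 < c -> is_derive (c : R) (1 : R) e (resonant_part m b c).
  move=> c0; have dC := is_derive_apow m12 c0; have dq := is_derive_quot b c0.
  have dl := is_derive1_ln c0.
  rewrite /e /resonant_part apowE ?(ltW c0) // C3 ?(ltW c0) // -apowE ?(ltW c0) //.
  apply: is_derive_eq; rewrite /GRing.scale /= /m.
  by field; rewrite !gt_eqF.
rewrite (indicatrix_volume_primitive m12 b01 e0 de).
congr (_%:E).
have -> : e 1 = - (3 / 16) * b ^+ 2 * b ^+ 4.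
  by rewrite /e /apow normr1 powR1 divr1 ln1 !mulr1 mulr0 subr0.
have -> : e b = - (3 / 16) * b ^+ 2 * b `^ (2 * m) - b ^+ 6 / 2 * ln b.
  rewrite /e apowE //; have [->|bn0] := eqVneq b 0; first by rewrite expr0n /=; ring.
  by rewrite divff // expr1n !mul1r.
have -> : b `^ (10 / 3) = b `^ (2 * m) * b ^+ 2.
  by rewrite -(powm_one m12 b01); congr (_ `^ _); rewrite /m; field.
have B3 := C3 b b0.
set be := b `^ (2 * m) in B3 *.
have B4 : be ^+ 4 = b ^+ 4 * be by rewrite exprSr B3.
rewrite /m.
have -> : (1 - be) * ((b / (2 / 3) * (1 - be)) ^+ 2 * (1 - be / 2)) =
    9 / 4 * b ^+ 2 * (1 - 7 / 2 * be + 9 / 2 * be ^+ 2 - 5 / 2 * be ^+ 3 + 1 / 2 * be ^+ 4).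
  by field.
rewrite B4 B3; clearbody be.
by field.
Qed.

Lemma volume_two (b : R) : 0 <= b -> b < 1 ->
  lebesgue_measure_C2 (kobayashi_indicatrix (ellipsoid 2) ((b%:C%C, 0) : C2 R)) =
  (pi ^+ 2 / 240 *
         (- (3 * b ^+ 14) - 25 * b ^+ 6 - 120 * (b ^+ 6 * ln b)
          + 288 * b ^+ 4 - 420 * b ^+ 2 + 160))%:E.
Proof.
move=> b0 b1; have b01 : 0 <= b < 1 by rewrite b0.
have m12 : 1 / 2 <= 2 :> R by lra.
have C1 (c : R) : 0 <= c -> c `^ (2 * 2) = c ^+ 4.
  by move=> c0; rewrite -powR_mulrn //; congr (_ `^ _); ring.
pose e c := b ^+ 6 / 2 * ln c - b ^+ 2 / 16 * ((b / c) ^+ 4 * apow 2 c ^+ 3).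
have e0 : b = 0 -> forall c, e c = 0.
  by move=> bE c; rewrite /e bE expr0n /=; ring.
have de (c : R) : 0 < c -> is_derive (c : R) (1 : R) e (resonant_part 2 b c).
  move=> c0; have dC := is_derive_apow m12 c0; have dq := is_derive_quot b c0.
  have dl := is_derive1_ln c0.
  rewrite /e /resonant_part; apply: is_derive_eq; rewrite /GRing.scale /=.
  rewrite !apowE ?(ltW c0) // C1 ?(ltW c0) //.
  by field; rewrite !gt_eqF.
rewrite (indicatrix_volume_primitive m12 b01 e0 de).
congr (_%:E).
have -> : e 1 = - (b ^+ 2 / 16 * b ^+ 4).
  by rewrite /e /apow normr1 powR1 divr1 ln1 expr1n !mulr1 mulr0 sub0r.
have -> : e b = b ^+ 6 / 2 * ln b - b ^+ 2 / 16 * b ^+ 12.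
  rewrite /e apowE // C1 //; have [->|bn0] := eqVneq b 0; first by rewrite expr0n /=; ring.
  by rewrite divff // expr1n !mul1r -exprM.
by rewrite C1 //; field.
Qed.
End formulas.

Theorem theorem1 (R : realType) :
  [/\ forall m b : R,
        1 / 2 <= m -> m <> 2 / 3 -> m <> 2 -> 0 <= b -> b < 1 ->
        lebesgue_measure_C2
          (kobayashi_indicatrix (ellipsoid m) (b%:C%C, 0%R)) =
        (pi ^+ 2 *
         (- ((m - 1) / (2 * m * (3 * m - 2) * (3 * m - 1)) * b `^ (6 * m + 2))
          - 3 * (m - 1) / (2 * m * (m - 2) * (m + 1)) * b `^ (2 * m + 2)
          + m / (2 * (m - 2) * (3 * m - 2)) * b ^+ 6
          + 3 * m / (3 * m - 1) * b ^+ 4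
          - (4 * m - 1) / (2 * m) * b ^+ 2
          + m / (m + 1)))%:E,
      forall b : R, 0 <= b -> b < 1 ->
        lebesgue_measure_C2
          (kobayashi_indicatrix (ellipsoid (2 / 3)) (b%:C%C, 0%R)) =
        (pi ^+ 2 / 80 *
         (- (65 * b ^+ 6) + 40 * (b ^+ 6 * ln b) + 160 * b ^+ 4
          - 27 * b `^ (10 / 3) - 100 * b ^+ 2 + 32))%:E
    & forall b : R, 0 <= b -> b < 1 ->
        lebesgue_measure_C2
          (kobayashi_indicatrix (ellipsoid 2) (b%:C%C, 0%R)) =
        (pi ^+ 2 / 240 *
         (- (3 * b ^+ 14) - 25 * b ^+ 6 - 120 * (b ^+ 6 * ln b)
          + 288 * b ^+ 4 - 420 * b ^+ 2 + 160))%:E].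
Proof.
by split; [exact: volume_generic|exact: volume_two_thirds|exact: volume_two].
Qed.
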